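(* Consider the fixed-sample-size model described in the context. Assume $g(0)>0$ and $g(1)<1$, and assume that the function $G:[0,1]\to\mathbb R$, $$G(q)=(1-2q)F_2(q)+(\beta+kq)F_1(q)-kq(1-q)-\beta q,$$ where $F_1(q)=\mathbf E[g(Y/k)]$ and $F_2(q)=\mathbf E[Yg(Y/k)]$ with $Y\sim\mathrm{Binomial}(k,q)$, has a unique root $q^*$ in $(0,1)$. Let $\Lambda=\{(a,b,c)\in\mathcal S:q_\beta(a,b,c)=q^*\}$. Then the sequence $\{(n^{-1}A_n,n^{-1}B_n,n^{-1}C_n)\}_{n\ge N}$ converges almost surely to a (possibly sample-path dependent) compact, connected, internally chain transitive invariant set, contained in $\Lambda$, corresponding to the autonomous ODE $$(\dot a(t),\dot b(t),\dot c(t))=h(a(t),b(t),c(t))\ \text{ for } t\ge 0,\qquad (a(0),b(0),c(0))=(A_N/N,0,0).$$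
   Context: **Model (fixed sample size).** Fix integers $N,k\ge 1$, a constant $\beta>0$, a memory parameter $p\in[0,1]\setminus\{1/2\}$, and a reinforcement function $f:[0,1]\to[0,1]$. Put $g(x)=pf(x)+(1-p)\{1-f(x)\}$, so $g:[0,1]\to[0,1]$. $G_N$ is the graph with vertices $v_1,\dots,v_N$ and no edges; each $v_i$ ($i\le N$) has an arbitrary state $X_i\in\{+1,-1\}$. For $n\ge N$, given the $\sigma$-field $\mathcal F_n$ of all information up to and including epoch $n$ (i.e. the directed multigraph $G_n$ on $v_1,\dots,v_n$, its states and its history), a new vertex $v_{n+1}$ arrives and indices $U_{n,1},\dots,U_{n,k}$ are drawn, conditionally i.i.d. given $\mathcal F_n$, with $$\mathbf P[U_{n,1}=m\mid\mathcal F_n]=\frac{\mathrm{indeg}_n(v_m)+\beta}{\sum_{j=1}^n \mathrm{indeg}_n(v_j)+n\beta},\quad m\in\{1,\dots,n\},$$ where $\mathrm{indeg}_n(v)$ is the in-degree of $v$ in $G_n$, counted with multiplicity. Let $P_n=\#\{i\le k: X_{U_{n,i}}=+1\}$. Given $\mathcal F_n$ and the sample, $X_{n+1}=+1$ with probability $g(P_n/k)$ and $X_{n+1}=-1$ with probability $1-g(P_n/k)$. Then, for each $i\in\{1,\dots,k\}$ with $X_{U_{n,i}}=X_{n+1}$, a directed edge from $v_{n+1}$ to $v_{U_{n,i}}$ is added (repeated edges kept), giving $G_{n+1}$. States never change afterwards. **Statistics.** $A_n=\#\{i\le n:X_i=+1\}$, $B_n=\sum_{i\le n,\,X_i=+1}\mathrm{indeg}_n(v_i)$,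 $C_n=\sum_{i\le n}\mathrm{indeg}_n(v_i)$. **Drift.** $\mathcal S=\{(a,b,c)\in[0,1]\times[0,k]\times[0,k]:c\ge b\}$; $q_\beta(a,b,c)=\frac{b+\beta a}{c+\beta}\in[0,1]$ for $(a,b,c)\in\mathcal S$. With $Y\sim\mathrm{Binomial}(k,q_\beta(a,b,c))$, set $H_1(a,b,c)=\mathbf E[g(Y/k)]$, $H_2(a,b,c)=\mathbf E[Yg(Y/k)]$, $H_3(a,b,c)=\mathbf E[Yg(Y/k)+(k-Y)\{1-g(Y/k)\}]$, $H=(H_1,H_2,H_3)$, and $h(a,b,c)=H(a,b,c)-(a,b,c)$ on $\mathcal S$. **Dynamical notions.** For a (well-posed) ODE $\dot{\mathbf x}=h(\mathbf x)$, a set $A\subset\mathcal S$ is *invariant* if for every $\mathbf u\in A$ the solution $\mathbf x_{\mathbf u}$ with $\mathbf x_{\mathbf u}(0)=\mathbf u$ is defined for all $t\in\mathbb R$ and stays in $A$ for all $t\in\mathbb R$. A set $A$ is *internally chain transitive* if it is invariant, compact, and for all $\mathbf u,\mathbf v\in A$, $\epsilon>0$, $T>0$ there are $m\ge1$, points $\mathbf u_0=\mathbf u,\mathbf u_1,\dots,\mathbf u_m=\mathbf v$ in $A$ and times $t_1,\dots,t_m\ge T$ with $\|\mathbf x_{\mathbf u_{i-1}}(t_i)-\mathbf u_i\|<\epsilon$ for all $i\in\{1,\dots,m\}$. A sequence $z_n$ converges to a set $L$ if $\inf_{\mathbf w\in L}\|z_n-\mathbf w\|\to0$. *)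

(* Defs.v *)
From HB Require Import structures.
From mathcomp Require Import all_boot all_order all_algebra.
From mathcomp Require Import all_classical all_reals all_analysis.
Set Implicit Arguments.
Unset Strict Implicit.
Unset Printing Implicit Defensive.
Import Order.TTheory GRing.Theory Num.Theory.
Import numFieldNormedType.Exports.
Local Open Scope classical_set_scope.
Local Open Scope ring_scope.

(* Vertices are numbered from 0, so that the vertices present at epoch n are   *)
(* the v with v < n and the vertex arriving at epoch n is n itself.  A sample  *)
(* path is a pair (x, u), where x v is the state of the vertex v (true stands  *)
(* for +1 and false for -1) and u n j is the j-th index sampled at epoch n.    *)
(* The values u n j with n < N are never used.                                 *)
Section Path.
Variables (N k : nat) (x : nat -> bool) (u : nat -> 'I_k -> nat).

(* Directed edges (source, target) of the multigraph at epoch n, with          *)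
(* repetitions.                                                                *)
Fixpoint edges (n : nat) : seq (nat * nat) :=
  if n is m.+1 then
    if (N <= m)%N then
      edges m ++ [seq (m, u m j) | j <- enum 'I_k & x (u m j) == x m]
    else [::]
  else [::].

Definition indeg (n v : nat) : nat := count (fun e => e.2 == v) (edges n).

Definition attach_prob (R : realType) (beta : R) (n v : nat) : R :=
  ((indeg n v)%:R + beta) / ((\sum_(w < n) indeg n w)%N%:R + n%:R * beta).

Definition sample_plus (n : nat) : nat := #|[set j : 'I_k | x (u n j)]%SET|.

Definition statA (n : nat) : nat := #|[set i : 'I_n | x i]%SET|.

Definition statB (n : nat) : nat := (\sum_(i < n | x i) indeg n i)%N.

Definition statC (n : nat) : nat := (\sum_(i < n) indeg n i)%N.

End Path.

Definition scaled_stats (R : realType) (N k : nat) (x : nat -> bool)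
    (u : nat -> 'I_k -> nat) (n : nat) : R * R * R :=
  ((statA x n)%:R / n%:R, (statB N x u n)%:R / n%:R,
   (statC N x u n)%:R / n%:R).

Section Model.
Context {d : measure_display} {T : measurableType d} {R : realType}.

(* f is a version of the conditional probability of E given the sigma-field F. *)
Definition is_cond_prob (P : probability T R) (F : set (set T)) (E : set T)
    (f : T -> R) : Prop :=
  (forall V : set R, measurable V -> F (f @^-1` V)) /\
  (forall B : set T, F B -> P (E `&` B) = (\int[P]_(w in B) (f w)%:E)%E).

Variables (N k : nat) (X : nat -> T -> bool) (U : nat -> 'I_k -> T -> nat).

Definition path_states (w : T) : nat -> bool := fun i => X i w.

Definition path_samples (w : T) : nat -> 'I_k -> nat := fun n j => U n j w.

(* The sigma-field F_n: the states of the vertices present at epoch n and the  *)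
(* samples drawn before epoch n (which determine the multigraph).              *)
Definition history (n : nat) : set (set T) :=
  <<s [set E | exists i, exists s : bool,
         (i < n)%N /\ E = [set w | X i w = s]] `|`
      [set E | exists l, exists j, exists m,
         (N <= l < n)%N /\ E = [set w | U l j w = m]] >>.

Definition history_and_sample (n : nat) : set (set T) :=
  <<s history n `|`
      [set E | exists j, exists m, E = [set w | U n j w = m]] >>.

Definition gfun (p : R) (f : R -> R) (y : R) : R :=
  p * f y + (1 - p) * (1 - f y).

(* Conditional independence and identical distribution of the sample are       *)
(* expressed by its conditional joint mass function being a product.           *)
Record polya_model (P : probability T R) (beta p : R) (f : R -> R) : Prop :=
  PolyaModel {
    polya_measurable_states : forall i, measurable_fun setT (X i);
    polya_measurable_samples : forall n j, (N <= n)%N ->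
      measurable_fun setT (U n j);
    polya_samples_lt : forall n j w, (N <= n)%N -> (U n j w < n)%N;
    polya_samples_law : forall n (m : 'I_k -> nat), (N <= n)%N ->
      (forall j, (m j < n)%N) ->
      is_cond_prob P (history n) [set w | forall j, U n j w = m j]
        (fun w => \prod_(j < k)
           attach_prob N (path_states w) (path_samples w) beta n (m j));
    polya_state_law : forall n, (N <= n)%N ->
      is_cond_prob P (history_and_sample n) [set w | X n w = true]
        (fun w => gfun p f
           ((sample_plus (path_states w) (path_samples w) n)%:R / k%:R))
  }.

End Model.

Section Drift.
Context {R : realType}.
Variables (k : nat) (beta : R) (g : R -> R).

(* E[phi(Y)] with Y ~ Binomial(k, q), for q in [0, 1]. *)
Definition binomial_mean (q : R) (phi : nat -> R) : R :=
  fine ('E_(binomial_prob k q)[phi])%E.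

Definition drift_domain : set (R * R * R) :=
  [set z | [/\ 0 <= z.1.1 <= 1, 0 <= z.1.2 <= k%:R, 0 <= z.2 <= k%:R &
            z.1.2 <= z.2]].

Definition qbeta (z : R * R * R) : R :=
  (z.1.2 + beta * z.1.1) / (z.2 + beta).

Definition F1 (q : R) : R := binomial_mean q (fun y => g (y%:R / k%:R)).

Definition F2 (q : R) : R := binomial_mean q (fun y => y%:R * g (y%:R / k%:R)).

Definition F3 (q : R) : R :=
  binomial_mean q (fun y => y%:R * g (y%:R / k%:R)
                            + (k%:R - y%:R) * (1 - g (y%:R / k%:R))).

Definition drift (z : R * R * R) : R * R * R :=
  (F1 (qbeta z), F2 (qbeta z), F3 (qbeta z)) - z.

Definition Gfun (q : R) : R :=
  (1 - 2 * q) * F2 q + (beta + k%:R * q) * F1 q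
  - k%:R * q * (1 - q) - beta * q.

End Drift.

(* The notions below refer to the ODE x' = h(x) for a field h on a domain D.   *)
(* They quantify over all starting points in A, so an initial condition        *)
(* attached to the ODE does not enter them.  Solutions take their values in D. *)
(* "The solution started at u" is rendered by existence together with          *)
(* quantification over all solutions, so that no choice of a solution is       *)
(* involved.                                                                   *)
Section Dynamics.
Context {R : realType} {V : normedModType R}.
Variables (D : set V) (h : V -> V).

Definition ode_solution (u : V) (x : R -> V) : Prop :=
  x 0 = u /\ forall t : R, D (x t) /\ is_derive t 1 x (h (x t)).

Definition ode_invariant (A : set V) : Prop :=
  A `<=` D /\
  forall u, A u ->
    (exists x, ode_solution u x) /\
    (forall x, ode_solution u x -> forall t, A (x t)).

Definition internally_chain_transitive (A : set V) : Prop :=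
  [/\ ode_invariant A, compact A &
    forall (u v : V) (eps T0 : R), A u -> A v -> 0 < eps -> 0 < T0 ->
      exists (m : nat) (us : nat -> V) (ts : nat -> R),
        [/\ (0 < m)%N, us 0%N = u, us m = v,
            (forall i, (i <= m)%N -> A (us i)) &
            (forall i, (i < m)%N -> T0 <= ts i /\
               forall x, ode_solution (us i) x ->
                 `|x (ts i) - us i.+1| < eps)]].

(* The extended infimum is used because it is +oo, not 0, for L = set0. *)
Definition cvg_to_set (z : nat -> V) (L : set V) : Prop :=
  (ereal_inf [set (`|z n - w|)%:E | w in L] @[n --> \oo] --> 0%E).

End Dynamics.

(* Main.v *)
Require Import Defs.
From HB Require Import structures.
From mathcomp Require Import all_boot all_order all_algebra.
From mathcomp Require Import all_classical all_reals all_analysis.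
From mathcomp Require Import measurable_realfun.
From mathcomp Require Import ring lra zify.
Import Order.TTheory GRing.Theory Num.Theory.
Import numFieldNormedType.Exports.
Set Implicit Arguments.
Unset Strict Implicit.
Unset Printing Implicit Defensive.
Local Open Scope classical_set_scope.
Local Open Scope ring_scope.

(** Write [Hs] for the triple [(F1 qs, F2 qs, F3 qs)].  On the set where
    [qbeta = qs] the drift is [z |-> Hs - z], whose complete orbits other than
    [Hs] grow exponentially in backward time; a nonempty bounded invariant
    subset of that set can therefore only be [{Hs}].  So the limit set is the
    equilibrium [{Hs}] on almost every path, and the theorem splits into the
    almost sure convergence of the scaled statistics to [Hs] and the
    uniqueness of the solution of the ODE started at [Hs].

    Convergence.  Given the history, a step changes the three statistics by
    [F1 Q], [F2 Q], [F3 Q] on average, where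
    [Q = (B + beta A) / (C + beta n)] is [qbeta] of the scaled statistics:
    a product law on the samples makes the number of sampled +1 vertices
    binomial ([sum_over_samples]).  The accumulated deviations from these
    means have orthogonal bounded increments ([noise_orthogonal]), hence a
    second moment of order [n]; summing along the squares
    and interpolating between them shows that they are [o(n)] almost surely
    ([noise_sum_small]).  The rest is deterministic.  Up to a vanishing error
    the ratio [Q] follows the recursion with increments
    [(F2 q + beta F1 q - q (F3 q + beta)) / V = G(q) / V], with [V] of order
    [n].  As [G 0 = beta * g 0 > 0], [G 1 = beta * (g 1 - 1) < 0] and [qs] is
    the only root, [G] is positive to the left of [qs] and negative to its
    right, so that [Q] is driven to [qs] because the harmonic series diverges
    ([perturbed_ratio_cvg]).  Averaging [Fi Q] then gives the limit [Fi qs]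
    for each statistic.

    Uniqueness.  Along a solution, [y = b + beta a - qs (c + beta)] satisfies
    [|y'| <= K |y|], since [G] is a polynomial vanishing at [qs]; by a
    Gronwall argument [y = 0], that is, [qbeta = qs] for all times, and then
    every coordinate obeys [z' = l - z] with [z 0 = l]
    ([ode_solution_equilibrium]). *)

(** * Recursions of the statistics along a sample path *)

Section PathRecursions.
Variables (N k : nat) (x : nat -> bool) (u : nat -> 'I_k -> nat).
Hypothesis u_lt : forall n j, (N <= n)%N -> (u n j < n)%N.

Lemma edges_target_lt n e : e \in edges N x u n -> (e.2 < n)%N.
Proof.
elim: n => [//|n IH] /=; case: ifP => // Nn.
rewrite mem_cat => /orP[/IH/ltnW//|/mapP[j _ ->]] /=.
by rewrite ltnS ltnW// u_lt.
Qed.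

Lemma indeg_new n v : (n <= v)%N -> indeg N x u n v = 0%N.
Proof.
move=> nv; apply/eqP; rewrite -leqn0 leqNgt -has_count; apply/hasPn => e.
by move/edges_target_lt => en; rewrite neq_ltn (leq_trans en).
Qed.

Lemma indeg_initial n v : (n <= N)%N -> indeg N x u n v = 0%N.
Proof. by case: n => [//|n] nN; rewrite /indeg /= leqNgt nN. Qed.

Lemma indegS n v : (N <= n)%N -> indeg N x u n.+1 v =
  (indeg N x u n v + \sum_(j < k | x (u n j) == x n) (u n j == v))%N.
Proof.
move=> Nn; rewrite /indeg /= Nn count_cat count_map; congr addn.
rewrite -sum1_count big_filter_cond/= -big_mkcondr /=.
by rewrite big_enum_cond.
Qed.

(** An edge drawn at epoch [n] is counted once, at its target; with [Q] the
    set of +1 vertices this gives the recursion of [statB], with [Q] full the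
    one of [statC]. *)
Lemma sum_indegS n (Q : pred nat) : (N <= n)%N ->
  (\sum_(i < n.+1 | Q i) indeg N x u n.+1 i =
   \sum_(i < n | Q i) indeg N x u n i +
   #|[set j : 'I_k | (x (u n j) == x n) && Q (u n j)]%SET|)%N.
Proof.
move=> Nn.
under eq_bigr do rewrite indegS//.
rewrite big_split /=; congr addn.
  by rewrite big_mkcond big_ord_recr/= -big_mkcond/= indeg_new// if_same addn0.
rewrite exchange_big/= -sum1_card.
rewrite [RHS](eq_bigl (fun j => (x (u n j) == x n) && Q (u n j))); last first.
  by move=> j; rewrite inE.
rewrite big_mkcondr/=; apply: eq_bigr => j _.
have lt := u_lt j Nn.
rewrite (eq_bigr (fun i : 'I_n.+1 => (i == inord (u n j)) : nat)); last first.
  by move=> i _; rewrite eq_sym -val_eqE/= inordK// ltnW.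
rewrite -big_mkcondr /= sum1_card.
case: ifP => Qj.
  rewrite (eq_card (_ : _ =i pred1 (inord (u n j)))) ?card1// => i.
  rewrite unfold_in /= !inE; case: (i =P inord _) => [->|_].
    by rewrite inordK ?Qj// ltnW.
  by rewrite andbF.
rewrite (eq_card (_ : _ =i pred0)) ?card0// => i.
rewrite unfold_in /= !inE; case: (i =P inord _) => [->|_].
  by rewrite inordK ?Qj// ltnW.
by rewrite andbF.
Qed.

Lemma statAS n : statA x n.+1 = (statA x n + x n)%N.
Proof.
rewrite /statA -!sum1_card.
under eq_bigl do rewrite inE.
under [in RHS]eq_bigl do rewrite inE.
by rewrite big_mkcond big_ord_recr/= -big_mkcond/=; case: (x n).
Qed.

Lemma statBS n : (N <= n)%N -> statB N x u n.+1 =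
  (statB N x u n + if x n then sample_plus x u n else 0)%N.
Proof.
move=> Nn; rewrite /statB (sum_indegS x Nn); congr addn.
rewrite /sample_plus; case: (x n).
  by apply: eq_card => j; rewrite !inE; case: (x _).
by apply: eq_card0 => j; rewrite !inE; case: (x _).
Qed.

Lemma statCS n : (N <= n)%N -> statC N x u n.+1 =
  (statC N x u n + if x n then sample_plus x u n else k - sample_plus x u n)%N.
Proof.
move=> Nn; rewrite /statC (sum_indegS xpredT Nn); congr addn.
rewrite /sample_plus; case: (x n).
  by apply: eq_card => j; rewrite !inE andbT; case: (x _).
have := cardsC [set j : 'I_k | x (u n j)]%SET; rewrite card_ord => kE.
suff -> : #|[set j : 'I_k | (x (u n j) == false) && true]%SET| =
          #|~: [set j : 'I_k | x (u n j)]%SET| by move: kE; lia.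
by apply: eq_card => j; rewrite !inE andbT; case: (x _).
Qed.

Lemma sample_plus_le n : (sample_plus x u n <= k)%N.
Proof. by rewrite /sample_plus -[X in (_ <= X)%N](card_ord k) max_card. Qed.

Lemma statC_le n : (N <= n)%N -> (statC N x u n <= k * n)%N.
Proof.
elim: n => [|n IH].
  by move=> _; rewrite /statC big_ord0.
rewrite leq_eqVlt => /orP[/eqP <-|].
  by rewrite /statC big1// => i _; rewrite indeg_initial.
rewrite ltnS => Nn; rewrite statCS// mulnS addnC leq_add ?IH//.
by case: ifP; rewrite ?leq_subr// sample_plus_le.
Qed.

End PathRecursions.

(** Everything that drives the step of epoch [n] depends only on the states
    of the first [n] vertices and on the samples drawn before [n], hence is
    constant on the atoms of the history. *)
Section Locality.
Variables (N k n : nat) (x x' : nat -> bool) (u u' : nat -> 'I_k -> nat).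
Hypothesis u_lt : forall l j, (N <= l)%N -> (u l j < l)%N.
Hypothesis eq_x : forall i, (i < n)%N -> x i = x' i.
Hypothesis eq_u : forall l j, (N <= l < n)%N -> u l j = u' l j.

Lemma edges_local m : (m <= n)%N -> edges N x u m = edges N x' u' m.
Proof.
elim: m => [//|m IH] mn /=; case: ifP => // Nm.
rewrite IH 1?ltnW//; congr cat.
have eqm j : u m j = u' m j by rewrite eq_u// Nm.
have eqs j : (x (u m j) == x m) = (x' (u' m j) == x' m).
  by rewrite -eqm eq_x ?eq_x// (ltn_trans (u_lt j Nm)).
rewrite (eq_filter (a2 := fun j => x' (u' m j) == x' m)); last exact: eqs.
by apply: eq_map => j; rewrite eqm.
Qed.

Lemma indeg_local m v : (m <= n)%N -> indeg N x u m v = indeg N x' u' m v.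
Proof. by move=> mn; rewrite /indeg edges_local. Qed.

Lemma attach_prob_local (R : realType) (beta : R) m v : (m <= n)%N ->
  attach_prob N x u beta m v = attach_prob N x' u' beta m v.
Proof.
move=> mn; rewrite /attach_prob indeg_local//.
by under eq_bigr do rewrite indeg_local//.
Qed.

Lemma scaled_stats_local (R : realType) m : (m <= n)%N ->
  scaled_stats R N x u m = scaled_stats R N x' u' m.
Proof.
move=> mn.
have e (i : 'I_m) : x i = x' i by rewrite eq_x// (leq_trans (ltn_ord i)).
rewrite /scaled_stats; congr (_%:R / _, _%:R / _, _%:R / _).
- by apply: eq_card => i; rewrite !inE.
- by apply: eq_big => // i _; rewrite indeg_local.
- by apply: eq_bigr => i _; rewrite indeg_local.
Qed.

Lemma sample_plus_local m : (N <= m < n)%N ->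
  sample_plus x u m = sample_plus x' u' m.
Proof.
move=> /andP[Nm mn]; apply: eq_card => j.
by rewrite !inE -eq_u ?Nm// eq_x// (ltn_trans (u_lt j Nm)).
Qed.

End Locality.

Section AttachmentLaw.
Variables (R : realType) (N k : nat) (x : nat -> bool) (u : nat -> 'I_k -> nat).
Variable beta : R.
Hypothesis beta_gt0 : 0 < beta.
Variable n : nat.
Hypothesis n_gt0 : (0 < n)%N.

Let total_gt0 : 0 < (statC N x u n)%:R + n%:R * beta.
Proof. by rewrite ltr_wpDl ?ler0n// mulr_gt0// ltr0n. Qed.

Lemma qbeta_scaled : qbeta beta (scaled_stats R N x u n) =
  ((statB N x u n)%:R + beta * (statA x n)%:R) /
  ((statC N x u n)%:R + n%:R * beta).
Proof.
have n0 : n%:R != 0 :> R by rewrite pnatr_eq0 -lt0n.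
rewrite /qbeta /=; field; apply/andP; split; [exact: lt0r_neq0|exact: n0].
Qed.

Lemma sum_attach_prob : \sum_(v < n) attach_prob N x u beta n v = 1.
Proof.
rewrite /attach_prob -mulr_suml big_split/= sumr_const card_ord -natr_sum.
by rewrite -[beta *+ n]mulr_natl mulfV// lt0r_neq0.
Qed.

(** The conditional probability of sampling a +1 vertex is [qbeta] of the
    scaled statistics. *)
Lemma sum_attach_prob_plus :
  \sum_(v < n | x v) attach_prob N x u beta n v =
  qbeta beta (scaled_stats R N x u n).
Proof.
rewrite qbeta_scaled /attach_prob -mulr_suml big_split/= -natr_sum sumr_const.
by congr ((_ + _) / _); rewrite -[LHS]mulr_natr /statA cardsE.
Qed.

Lemma attach_prob_ge0 v : 0 <= attach_prob N x u beta n v.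
Proof. by rewrite divr_ge0 ?addr_ge0 ?ler0n ?mulr_ge0// ltW. Qed.

Lemma qbeta_scaled_01 : 0 <= qbeta beta (scaled_stats R N x u n) <= 1.
Proof.
rewrite -sum_attach_prob_plus sumr_ge0/= => [|v _]; last exact: attach_prob_ge0.
rewrite -sum_attach_prob [leRHS](bigID (fun v : 'I_n => x v))/= lerDl.
by rewrite sumr_ge0// => v _; exact: attach_prob_ge0.
Qed.

End AttachmentLaw.

(** * Binomial means *)

Section BinomialMean.
Variable R : realType.
Variable k : nat.
Implicit Types (q : R) (phi : nat -> R).

(** The expectation of [phi] under Binomial(k, q) as a polynomial in [q]:
    continuity, boundedness and factorisation at a root come for free. *)
Definition binomial_mean_poly phi : {poly R} :=
  \sum_(i < k.+1) (phi i * 'C(k, i)%:R) *: ('X ^+ i * (1 - 'X) ^+ (k - i)).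

Lemma horner_binomial_mean_poly q phi : (binomial_mean_poly phi).[q] =
  \sum_(i < k.+1) phi i * (q ^+ i * (1 - q) ^+ (k - i) *+ 'C(k, i)).
Proof.
rewrite /binomial_mean_poly horner_sum; apply: eq_bigr => i _.
rewrite hornerZ hornerM !horner_exp hornerD hornerN hornerX hornerC.
by rewrite -mulrA mulr_natl.
Qed.

Lemma binomial_meanE q phi : 0 <= q <= 1 ->
  binomial_mean k q phi = (binomial_mean_poly phi).[q].
Proof.
move=> q01; have /andP[q0 q1] := q01; rewrite /binomial_mean unlock.
rewrite integralE !(@integral_binomial R k q q0 q1)//.
rewrite -[(fun x => (phi x)%:E)]/(EFin \o phi) funerpos funerneg /=.
have Es (g : nat -> R) :
    (\sum_(i < k.+1) ((@bin_prob R k q q0 q1 i)%:num)%:E * (g i)%:E)%E =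
    (\sum_(i < k.+1) (@bin_prob R k q q0 q1 i)%:num * g i)%:E.
  by rewrite -sumEFin; apply: eq_bigr => i _; rewrite EFinM.
rewrite !Es -EFinB /= -sumrB horner_binomial_mean_poly; apply: eq_bigr => i _.
rewrite -mulrBr mulrC; congr (_ * _).
by rewrite -[in RHS](funrposBneg phi).
Qed.

(** For [k] independent draws with law [a], the number of draws with
    [x = true] is binomial.  The sum is grouped by the set [S] of indices of
    such draws; for each [S] the sum of products factors over the draws. *)
Lemma sum_over_samples (n : nat) (x : nat -> bool) (a : 'I_n -> R) phi :
  \sum_(v < n) a v = 1 ->
  \sum_(m : {ffun 'I_k -> 'I_n})
     (\prod_(j < k) a (m j)) * phi #|[set j : 'I_k | x (m j)]%SET| =
  (binomial_mean_poly phi).[\sum_(v < n | x v) a v].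
Proof.
move=> a1; set q := \sum_(v < n | x v) a v.
have q' : \sum_(v < n | ~~ x v) a v = 1 - q.
  have := a1; rewrite (bigID (fun v : 'I_n => x v))/= -/q => <-.
  by rewrite addrAC subrr add0r.
pose plus (m : {ffun 'I_k -> 'I_n}) := [set j : 'I_k | x (m j)]%SET.
rewrite (partition_big plus xpredT)//=.
transitivity (\sum_(S : {set 'I_k})
    phi #|S| * (q ^+ #|S| * (1 - q) ^+ (k - #|S|))).
  apply: eq_bigr => S _.
  rewrite (eq_bigr (fun m : {ffun _} => phi #|S| * \prod_(j < k) a (m j)));
    last first.
    by move=> m /eqP <-; rewrite mulrC.
  rewrite -mulr_sumr; congr (_ * _).
  pose V (j : 'I_k) := [pred v : 'I_n | x v == (j \in S)].
  rewrite (eq_bigl (fun m => m \in family V)); last first.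
    move=> m; apply/eqP/familyP => [Sm j|mV].
      by rewrite inE -Sm inE.
    by apply/setP => j; rewrite inE; have := mV j; rewrite inE => /eqP.
  rewrite -(bigA_distr_big_dep V (fun _ v => a v)) /=.
  rewrite (bigID (mem S))/=; congr (_ * _).
    rewrite -prodr_const; apply: eq_bigr => j jS; apply: eq_bigl => v.
    by rewrite jS; case: (x v).
  have <- : #|~: S| = (k - #|S|)%N.
    by have := cardsC S; rewrite card_ord; lia.
  rewrite -prodr_const; apply: eq_big => j; first by rewrite inE.
  move=> jS; rewrite -q'; apply: eq_bigl => v.
  by rewrite (negbTE jS); case: (x v).
rewrite horner_binomial_mean_poly.
have cle (S : {set 'I_k}) : (#|S| < k.+1)%N.
  by rewrite ltnS -[X in (_ <= X)%N](card_ord k) max_card.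
rewrite (partition_big (fun S => Ordinal (cle S)) xpredT)//=.
apply: eq_bigr => i _.
rewrite (eq_bigr (fun=> phi i * (q ^+ i * (1 - q) ^+ (k - i)))); last first.
  by move=> S /eqP <-.
rewrite sumr_const [RHS]mulrnAr; congr (_ *+ _).
have := card_draws 'I_k i; rewrite card_ord => <-; rewrite cardsE.
by apply: eq_card => S; rewrite unfold_in.
Qed.

End BinomialMean.

Section BinomialMoments.
Variables (R : realType) (k : nat).
Implicit Types (q : R) (phi psi : nat -> R).

Lemma binomial_mean_le q phi psi : 0 <= q <= 1 ->
  (forall i, (i <= k)%N -> phi i <= psi i) ->
  binomial_mean k q phi <= binomial_mean k q psi.
Proof.
move=> q01 le; rewrite !binomial_meanE// !horner_binomial_mean_poly.
have /andP[q0 q1] := q01.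
apply: ler_sum => i _; rewrite ler_wpM2r ?le//; last by rewrite -ltnS.
by rewrite mulrn_wge0// mulr_ge0// exprn_ge0// subr_ge0.
Qed.

Lemma binomial_mean_cst q c : 0 <= q <= 1 -> binomial_mean k q (fun=> c) = c.
Proof.
move=> q01; rewrite binomial_meanE// horner_binomial_mean_poly -mulr_sumr.
transitivity (c * (1 - q + q) ^+ k); last by rewrite subrK expr1n mulr1.
by rewrite exprDn; congr (_ * _); apply: eq_bigr => i _; rewrite mulrC.
Qed.

Lemma binomial_mean_id q : 0 <= q <= 1 ->
  binomial_mean k q (fun i => i%:R) = k%:R * q.
Proof.
move=> q01; rewrite binomial_meanE// horner_binomial_mean_poly.
case: k => [|m]; first by rewrite big_ord_recl big_ord0 !mul0r addr0.
rewrite big_ord_recl mul0r add0r.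
transitivity (m.+1%:R * q * (1 - q + q) ^+ m).
  rewrite exprDn mulr_sumr; apply: eq_bigr => i _.
  rewrite lift0 subSS exprS [LHS]mulrnAr [RHS]mulrnAr.
  rewrite -[LHS]mulr_natr -[RHS]mulr_natr.
  transitivity ((i.+1 * 'C(m.+1, i.+1))%:R *
    (q * (q ^+ i * (1 - q) ^+ (m - i)))).
    by rewrite natrM; ring.
  by rewrite -mul_bin_diag natrM; ring.
by rewrite subrK expr1n mulr1.
Qed.

Lemma binomial_meanD q phi psi : 0 <= q <= 1 ->
  binomial_mean k q (fun i => phi i + psi i) =
  binomial_mean k q phi + binomial_mean k q psi.
Proof.
move=> q01; rewrite !binomial_meanE// !horner_binomial_mean_poly -big_split/=.
by apply: eq_bigr => i _; rewrite mulrDl.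
Qed.

Lemma binomial_meanZ q c phi : 0 <= q <= 1 ->
  binomial_mean k q (fun i => c * phi i) = c * binomial_mean k q phi.
Proof.
move=> q01; rewrite !binomial_meanE// !horner_binomial_mean_poly mulr_sumr.
by apply: eq_bigr => i _; rewrite mulrA.
Qed.

Lemma binomial_mean0 phi : binomial_mean k 0 phi = phi 0%N.
Proof.
rewrite binomial_meanE ?lexx ?ler01// horner_binomial_mean_poly.
rewrite big_ord_recl subr0 !expr1n bin0 !mulr1 big1 ?addr0// => i _.
by rewrite expr0n/= !mul0r mul0rn mulr0.
Qed.

Lemma binomial_mean1 phi : binomial_mean k 1 phi = phi k.
Proof.
rewrite binomial_meanE ?lexx ?ler01// horner_binomial_mean_poly.
rewrite big_ord_recr subrr /= subnn binn expr1n !mulr1 big1 ?add0r// => i _.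
by rewrite expr0n subn_eq0 leqNgt ltn_ord /= mulr0 mul0rn mulr0.
Qed.

Lemma binomial_mean_bound phi :
  exists2 M : R, 0 < M & forall q, 0 <= q <= 1 -> `|binomial_mean k q phi| <= M.
Proof.
have [M HM] := poly_itv_bound (binomial_mean_poly k phi) 0 1.
exists (`|M| + 1) => [|q q01]; first by rewrite ltr_wpDl.
rewrite binomial_meanE// (le_trans (HM q q01))//.
by rewrite (le_trans (ler_norm M))// lerDl.
Qed.

Lemma binomial_mean_cvg phi (Q : nat -> R) N q :
  (forall n, (N <= n)%N -> 0 <= Q n <= 1) -> 0 <= q <= 1 ->
  Q @ \oo --> q ->
  (fun n => binomial_mean k (Q n) phi) @ \oo --> binomial_mean k q phi.
Proof.
move=> Q01 q01 Qq; rewrite binomial_meanE//.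
have : (fun n => (binomial_mean_poly k phi).[Q n]) @ \oo -->
    (binomial_mean_poly k phi).[q].
  have h := @continuous_horner R (binomial_mean_poly k phi) q.
  exact: (continuous_cvg _ h Qq).
apply: cvg_trans; apply: near_eq_cvg; near=> n.
by rewrite binomial_meanE// Q01//; near: n; exact: nbhs_infty_ge.
Unshelve. all: by end_near. Qed.

End BinomialMoments.

(** * Ratios of perturbed recursions *)

(** As steps are [O(1/n)], a sequence that has got below [l] can no longer
    jump above [l']; and it does get below [l], because decrements of at least
    [c/n] add up to infinity. *)
Lemma eventually_le_of_descent (R : realType) (y : nat -> R) (l l' c C : R) :
  0 < c -> l < l' ->
  (\forall n \near \oo, l <= y n -> y n.+1 <= y n - c * n.+1%:R^-1) ->
  (\forall n \near \oo, y n.+1 <= y n + C * n.+1%:R^-1) ->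
  \forall n \near \oo, y n <= l'.
Proof.
move=> c0 ll' down up.
have small : \forall n \near \oo, C * n.+1%:R^-1 <= l' - l.
  have : (fun n => C * (n.+1%:R^-1 : R)) @ \oo --> C * 0.
    by apply: cvgM; [exact: cvg_cst|exact: cvg_harmonic].
  rewrite mulr0 => /cvgr_le; apply.
  by rewrite subr_gt0.
have [M _ HM] : \forall n \near \oo,
    [/\ l <= y n -> y n.+1 <= y n - c * n.+1%:R^-1,
    y n.+1 <= y n + C * n.+1%:R^-1 & C * n.+1%:R^-1 <= l' - l].
  by near=> n; split; near: n.
have [[n0 [Mn0 yn0]]|above] := pselect (exists n, (M <= n)%N /\ y n < l).
  suff le_l' n : (n0 <= n)%N -> y n <= l' by exists n0 => // n; exact: le_l'.
  elim: n => [|n IH].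
    by rewrite leqn0 => /eqP <-; rewrite ltW// (lt_trans yn0).
  rewrite leq_eqVlt => /orP[/eqP <-|]; first by rewrite ltW// (lt_trans yn0).
  rewrite ltnS => n0n; have {IH}yn := IH n0n.
  have [dn un sn] := HM n (leq_trans Mn0 n0n).
  have [ly|yl] := leP l (y n).
    apply: le_trans (dn ly) _; apply: le_trans yn.
    by rewrite gerBl mulr_ge0// ltW.
  by rewrite (le_trans un)// -[leRHS](subrK l) addrC lerD// ltW.
have {}above n : (M <= n)%N -> l <= y n.
  by move=> Mn; rewrite leNgt; apply/negP => yl; apply: above; exists n.
(* Staying above [l] forever would bound the harmonic series. *)
have nondecH : nondecreasing_seq (series (@harmonic R)).
  apply/nondecreasing_seqP => n; rewrite seriesSr lerDl.
  by rewrite /harmonic/= invr_ge0.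
exfalso; apply: (@dvg_harmonic R); apply: nondecreasing_is_cvgn => //.
exists (series harmonic M + (y M - l) / c) => _ [n _ <-].
have [nM|Mn] := leqP n M.
  rewrite (@le_trans _ _ (series harmonic M))//; first exact: nondecH.
  by rewrite lerDl divr_ge0 ?(ltW c0)// subr_ge0 above.
rewrite -lerBlDl ler_pdivlMr//.
suff : y n <= y M - (series harmonic n - series harmonic M) * c.
  by have := above n (ltnW Mn); lra.
elim: n Mn => [//|n IH].
rewrite ltnS leq_eqVlt => /orP[/eqP <-|Mn].
  have [dn _ _] := HM M (leqnn _).
  apply: le_trans (dn (above _ (leqnn _))) _.
  rewrite seriesSr /harmonic /= [X in _ <= _ - X * _]addrAC subrr add0r.
  by rewrite mulrC.
have {}IH := IH Mn.
have [dn _ _] := HM n (ltnW Mn).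
apply: le_trans (dn (above _ (ltnW Mn))) _.
rewrite seriesSr /harmonic /=.
set s := series _ n in IH *; set t := series _ M in IH *.
set z := n.+1%:R^-1; nra.
Unshelve. all: by end_near. Qed.

(** The situation of [W = B + beta A] and [V = C + beta n] on one sample path:
    [SW] and [SV] are the partial sums of the noises, and everything else is
    a function of the ratio [W / V]. *)
Record perturbed_ratio (R : realType) (W V SW SV : nat -> R) (w v : R -> R)
    (N : nat) (b K : R) : Prop := PerturbedRatio {
  pr_start_gt0 : (0 < N)%N;
  pr_slope_gt0 : 0 < b;
  pr_bound_gt0 : 0 < K;
  pr_denom_bounds : forall n, (N <= n)%N -> b * n%:R <= V n <= K * n%:R;
  pr_ratio01 : forall n, (N <= n)%N -> 0 <= W n / V n <= 1;
  pr_numE : forall n, (N <= n)%N ->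
    W n.+1 = W n + w (W n / V n) + (SW n.+1 - SW n);
  pr_denomE : forall n, (N <= n)%N ->
    V n.+1 = V n + v (W n / V n) + (SV n.+1 - SV n);
  pr_num_noise : (fun n => SW n / n%:R) @ \oo --> 0;
  pr_denom_noise : (fun n => SV n / n%:R) @ \oo --> 0;
  pr_num_drift_le : forall q, 0 <= q <= 1 -> `|w q| <= K;
  pr_denom_drift_le : forall q, 0 <= q <= 1 -> `|v q| <= K }.

Section RatioRecursion.
Variables (R : realType) (W V SW SV : nat -> R) (w v : R -> R).
Variables (N : nat) (b K : R).
Hypothesis PR : perturbed_ratio W V SW SV w v N b K.
Let Q n := W n / V n.

(* Removing the noise makes [y] move by a deterministic amount at each step,
   while [Q n - y n] tends to 0. *)
Let y n := (W n - SW n) / (V n - SV n).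

Let small_near (S : nat -> R) (eta : R) : (fun n => S n / n%:R) @ \oo --> 0 ->
  0 < eta -> \forall n \near \oo, `|S n| <= eta * n%:R.
Proof.
move=> S0 eta0; near=> n.
have n0 : 0 < n%:R :> R by rewrite ltr0n; near: n; exact: nbhs_infty_gt.
rewrite -ler_pdivrMr// -[X in _ / X]gtr0_norm// -normf_div.
near: n; move/cvgr0_norm_le : S0; exact.
Unshelve. all: by end_near. Qed.

Let near_step (tau : R) : 0 < tau -> \forall n \near \oo,
  [/\ 0 <= Q n <= 1, `|Q n - y n| <= tau,
      y n.+1 = y n + (w (Q n) - y n * v (Q n)) / (V n.+1 - SV n.+1),
      b / 2 * n.+1%:R <= V n.+1 - SV n.+1 &
      V n.+1 - SV n.+1 <= 2 * K * n.+1%:R].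
Proof.
have [N_gt0 b_gt0 K_gt0 V_bounds Q01 WS VS SW_small SV_small w_le v_le] := PR.
move=> tau0.
pose eta := Num.min (Num.min (b / 2) K) (tau * (b / 4)).
have b2 : 0 < b / 2 by rewrite divr_gt0.
have eta0 : 0 < eta by rewrite !lt_min b2 K_gt0 mulr_gt0// divr_gt0.
have Vt : \forall n \near \oo, b / 2 * n%:R <= V n - SV n <= 2 * K * n%:R.
  near=> n.
  have Nn : (N <= n)%N by near: n; exact: nbhs_infty_ge.
  have sv : `|SV n| <= eta * n%:R by near: n; exact: small_near.
  have /andP[V1 V2] := V_bounds _ Nn.
  have n0 : 0 <= n%:R :> R by [].
  have e1 : eta * n%:R <= b / 2 * n%:R.
    by rewrite ler_wpM2r// /eta !ge_min lexx.
  have e2 : eta * n%:R <= K * n%:R.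
    by rewrite ler_wpM2r// /eta !ge_min lexx orbT.
  move: sv; rewrite ler_norml => /andP[s1 s2]; apply/andP; split; lra.
have Vt' : \forall n \near \oo,
    b / 2 * n.+1%:R <= V n.+1 - SV n.+1 <= 2 * K * n.+1%:R.
  by have [M _ HM] := Vt; exists M => // n /= Mn; apply: HM => /=; exact: leqW.
near=> n.
have Nn : (N <= n)%N by near: n; exact: nbhs_infty_ge.
have n0 : 0 < n%:R :> R by rewrite ltr0n; near: n; exact: nbhs_infty_gt.
have sv : `|SV n| <= eta * n%:R by near: n; exact: small_near.
have sw : `|SW n| <= eta * n%:R by near: n; exact: small_near.
have /andP[V1 V2] : b / 2 * n%:R <= V n - SV n <= 2 * K * n%:R by near: n.
have /andP[V1' V2'] :
    b / 2 * n.+1%:R <= V n.+1 - SV n.+1 <= 2 * K * n.+1%:R by near: n.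
have Vn0 : 0 < V n - SV n.
  by apply: lt_le_trans V1; rewrite !mulr_gt0// ?invr_gt0.
have Vn1 : 0 < V n.+1 - SV n.+1.
  by apply: lt_le_trans V1'; rewrite !mulr_gt0// ?invr_gt0.
have V0 : 0 < V n.
  by have /andP[+ _] := V_bounds _ Nn; apply: lt_le_trans; rewrite mulr_gt0.
have q01 := Q01 _ Nn; have /andP[q0 q1] := q01.
split => //.
- have -> : Q n - y n = (SW n - Q n * SV n) / (V n - SV n).
    by rewrite /Q /y; field; rewrite !lt0r_neq0.
  rewrite normf_div (gtr0_norm Vn0) ler_pdivrMr//.
  have e1 : eta * n%:R <= tau * (b / 4) * n%:R.
    by rewrite ler_wpM2r// /eta !ge_min lexx !orbT.
  apply: le_trans (ler_normB _ _) _; rewrite normrM.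
  have q' : `|Q n| * `|SV n| <= `|SV n| by rewrite ler_piMl// ger0_norm.
  have := ler_wpM2l (ltW tau0) V1; lra.
- rewrite /y WS// VS// in Vn1 *.
  have -> : W n + w (Q n) + (SW n.+1 - SW n) - SW n.+1 = W n - SW n + w (Q n).
    by ring.
  move: Vn1.
  have -> : V n + v (Q n) + (SV n.+1 - SV n) - SV n.+1 = V n - SV n + v (Q n).
    by ring.
  move=> Vn1; field; by rewrite !lt0r_neq0.
Unshelve. all: by end_near. Qed.

(** The increment of [y] is [(w Q - y v Q) / V], close to
    [(w Q - Q v Q) / V]; it is at most [- c'/n] as soon as [y] exceeds
    [qs + eps]. *)
Lemma perturbed_ratio_le (qs eps c : R) : 0 < eps -> 0 < c ->
  (forall q, 0 <= q <= 1 -> qs + eps / 2 <= q -> w q - q * v q <= - c) ->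
  \forall n \near \oo, Q n <= qs + 3 * eps.
Proof.
have [N_gt0 b_gt0 K_gt0 V_bounds Q01 WS VS SW_small SV_small w_le v_le] := PR.
move=> eps0 c0 Hc.
pose tau := Num.min (Num.min (eps / 2) 1) (c / (2 * K)).
have tau0 : 0 < tau by rewrite !lt_min ltr01 !divr_gt0// mulr_gt0.
have [t1 t2 t3] : [/\ tau <= eps / 2, tau <= 1 & tau <= c / (2 * K)].
  by rewrite /tau !ge_min !lexx !orbT.
have step := near_step tau0.
have : \forall n \near \oo, y n <= qs + 2 * eps.
  apply: (@eventually_le_of_descent _ y (qs + eps) _
    (c / 2 / (2 * K)) (3 * K / (b / 2))).
  - by rewrite !divr_gt0// mulr_gt0.
  - by lra.
  - apply: filterS step => n [q01 Qy -> V1 V2] yn.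
    have Vn1 : 0 < V n.+1 - SV n.+1.
      by apply: lt_le_trans V1; rewrite !mulr_gt0// ?invr_gt0.
    rewrite lerD2l lerNr -mulNr.
    have g : c / 2 <= - (w (Q n) - y n * v (Q n)).
      have := Hc _ q01; have := v_le _ q01; move: (Qy); rewrite !ler_norml.
      move=> /andP[Q1 Q2] /andP[v1 v2] /(_ _) G.
      have {}G := G ltac:(lra).
      have Qv : `|(Q n - y n) * v (Q n)| <= c / (2 * K) * K.
        by rewrite normrM ler_pM// ?v_le// (le_trans Qy).
      have cK : c / (2 * K) * K = c / 2 by field; rewrite lt0r_neq0.
      move: Qv; rewrite cK ler_norml => /andP[G1 G2]; lra.
    rewrite -mulrA -invfM; apply: ler_pM => //.
    + by rewrite divr_ge0// ltW.
    + by rewrite invr_ge0 !mulr_ge0// ltW.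
    + by rewrite lef_pV2 ?posrE// !mulr_gt0.
  - apply: filterS step => n [q01 Qy -> V1 V2].
    have Vn1 : 0 < V n.+1 - SV n.+1.
      by apply: lt_le_trans V1; rewrite !mulr_gt0// ?invr_gt0.
    rewrite lerD2l; apply: le_trans (ler_norm _) _.
    rewrite normrM -mulrA -invfM; apply: ler_pM => //.
      have y2 : `|y n| <= 2.
        move: Qy q01; rewrite !ler_norml => /andP[Q1 Q2] /andP[q0 q1]; lra.
      apply: le_trans (ler_normB _ _) _; rewrite normrM.
      have := ler_pM (normr_ge0 _) (normr_ge0 _) y2 (v_le _ q01).
      have := w_le _ q01; lra.
    rewrite gtr0_norm ?invr_gt0// lef_pV2 ?posrE// mulr_gt0//.
    by rewrite divr_gt0.
move=> yle; apply: filterS2 yle step => n yn [_ Qy _ _ _].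
move: Qy; rewrite ler_norml => /andP[Q1 Q2]; lra.
Qed.

(** Exchanging [Q] with [1 - Q] turns upper bounds into lower bounds. *)
Lemma perturbed_ratio_flip :
  perturbed_ratio (fun n => V n - W n) V (fun n => SV n - SW n) SV
    (fun q => v (1 - q) - w (1 - q)) (fun q => v (1 - q)) N b (2 * K).
Proof.
have [N_gt0 b_gt0 K_gt0 V_bounds Q01 WS VS SW_small SV_small w_le v_le] := PR.
have V0 n : (N <= n)%N -> V n != 0.
  move=> Nn; have /andP[+ _] := V_bounds _ Nn; move=> Vn.
  rewrite lt0r_neq0// (lt_le_trans _ Vn)// mulr_gt0//.
  by rewrite ltr0n (leq_trans N_gt0).
have flip n : (N <= n)%N -> (V n - W n) / V n = 1 - W n / V n.
  by move=> Nn; rewrite mulrBl divff// V0.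
have q1 (q : R) : 0 <= q <= 1 -> 0 <= 1 - q <= 1.
  by move=> /andP[? ?]; apply/andP; split; lra.
split => //.
- by rewrite mulr_gt0.
- move=> n Nn; have /andP[-> V2] := V_bounds _ Nn; rewrite /= (le_trans V2)//.
  by rewrite ler_wpM2r// ler_peMl// ?ler1n// ltW.
- by move=> n Nn; rewrite flip// q1// Q01.
- by move=> n Nn; rewrite flip// subKr WS// VS//; ring.
- by move=> n Nn; rewrite flip// subKr VS.
- rewrite (_ : (fun n => _) = fun n => SV n / n%:R - SW n / n%:R); last first.
    by apply/funext => n; rewrite mulrBl.
  by rewrite -[X in _ --> X](subrr 0); apply: cvgB.
- move=> q /q1 q01; apply: le_trans (ler_normB _ _) _.
  by rewrite mulr_natl mulr2n lerD ?v_le ?w_le.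
- move=> q /q1 q01; apply: le_trans (v_le _ q01) _.
  by rewrite ler_peMl// ?ler1n// ltW.
Qed.

End RatioRecursion.

Lemma perturbed_ratio_cvg (R : realType) (W V SW SV : nat -> R) (w v : R -> R)
    (N : nat) (b K qs : R) : perturbed_ratio W V SW SV w v N b K ->
  (forall eps, 0 < eps -> exists2 c, 0 < c &
    forall q, 0 <= q <= 1 -> qs + eps <= q -> w q - q * v q <= - c) ->
  (forall eps, 0 < eps -> exists2 c, 0 < c &
    forall q, 0 <= q <= 1 -> q <= qs - eps -> c <= w q - q * v q) ->
  (fun n => W n / V n) @ \oo --> qs.
Proof.
move=> PR dec inc; apply/cvgrPdist_le => eps eps0.
have e3 : 0 < eps / 3 by rewrite divr_gt0.
have e6 : 0 < eps / 3 / 2 by rewrite divr_gt0.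
have [c c0 Hc] := dec _ e6.
have [c' c'0 Hc'] := inc _ e6.
have up := perturbed_ratio_le PR e3 c0 Hc.
have /(perturbed_ratio_le (perturbed_ratio_flip PR) e3 c'0) lo :
    forall q, 0 <= q <= 1 -> (1 - qs) + eps / 3 / 2 <= q ->
    v (1 - q) - w (1 - q) - q * v (1 - q) <= - c'.
  move=> q /andP[q0 q1] qq; have := Hc' (1 - q); lra.
near=> n.
have U : W n / V n <= qs + 3 * (eps / 3) by near: n.
have L : (V n - W n) / V n <= 1 - qs + 3 * (eps / 3) by near: n.
have V0 : V n != 0.
  have Nn : (N <= n)%N by near: n; exact: nbhs_infty_ge.
  have /andP[Vn _] := pr_denom_bounds PR Nn; rewrite lt0r_neq0//.
  rewrite (lt_le_trans _ Vn)// mulr_gt0// ?(pr_slope_gt0 PR)//.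
  by rewrite ltr0n (leq_trans (pr_start_gt0 PR)).
move: L; rewrite mulrBl divff// => L.
by rewrite ler_norml; apply/andP; split; lra.
Unshelve. all: by end_near. Qed.

(** Up to the noise, [A n / n] is a Cesaro mean of [d]. *)
Lemma average_cvg (R : realType) (A S d : nat -> R) (l : R) (N : nat) :
  (forall n, (N <= n)%N -> A n.+1 = A n + d n + (S n.+1 - S n)) ->
  (fun n => S n / n%:R) @ \oo --> 0 -> d @ \oo --> l ->
  (fun n => A n / n%:R) @ \oo --> l.
Proof.
move=> AS S0 dl; rewrite -cvg_shiftS /=.
pose c := A N - S N - series d N.
have AE n : (N <= n)%N -> A n = c + series d n + S n.
  elim: n => [|n IH]; first by rewrite leqn0 => /eqP; rewrite /c => ->; ring.
  rewrite leq_eqVlt => /orP[/eqP <-|]; first by rewrite /c; ring.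
  by rewrite ltnS => Nn; rewrite AS// IH// seriesSr; ring.
have lim : (fun n => c * n.+1%:R^-1 + arithmetic_mean d n + S n.+1 / n.+1%:R)
    @ \oo --> c * 0 + l + 0.
  apply: cvgD; last by have := S0; rewrite -cvg_shiftS.
  apply: cvgD; last exact: cesaro.
  by apply: cvgM; [exact: cvg_cst|exact: cvg_harmonic].
rewrite mulr0 add0r addr0 in lim; apply: cvg_trans lim.
apply: near_eq_cvg; near=> n.
rewrite AE; first by rewrite /arithmetic_mean /=; ring.
by rewrite leqW//; near: n; exact: nbhs_infty_ge.
Unshelve. all: by end_near. Qed.

(** * Linear differential inequalities *)

Section Gronwall.
Variable R : realType.

(** [y^2 exp(-2Kt)] is nonincreasing and [y^2 exp(2Kt)] nondecreasing, both are
    nonnegative and vanish at 0; the first settles positive times and the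
    second negative ones. *)
Lemma gronwall_zero (y dy : R -> R) (K : R) :
  (forall t : R, is_derive t 1 y (dy t)) -> (forall t, `|dy t| <= K * `|y t|) ->
  y 0 = 0 -> forall t, y t = 0.
Proof.
move=> dyE dyK y0 t.
pose F (c s : R) := y s ^+ 2 * expR (c * s).
pose dF (c s : R) := (2 * y s * dy s + c * y s ^+ 2) * expR (c * s).
have FE c s : is_derive s (1 : R) (F c) (dF c s).
  have h := dyE s.
  have dl : is_derive s (1 : R) (fun s => c * s : R) c.
    have -> : (fun s => c * s : R) = c *: id by apply/funext.
    by apply: is_derive_eq; rewrite scaler1.
  have de := @is_derive1_comp R expR (fun s => c * s) s _ _
    (is_derive_expR _) dl.
  have -> : F c = (y ^+ 2) * (expR \o (fun s => c * s)) by apply/funext.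
  apply: is_derive_eq; rewrite /dF /= expr1.
  rewrite -[(y ^+ 2) s]/(y s ^+ 2) -![_ *: _]/(_ * _); ring.
have F0 c : F c 0 = 0 by rewrite /F y0 expr0n/= mul0r.
have Fge0 c s : 0 <= F c s by rewrite mulr_ge0 ?sqr_ge0 ?expR_ge0.
suff : F (if 0 <= t then - (2 * K) else 2 * K) t <= 0.
  move=> Ft; have /eqP : F (if 0 <= t then - (2 * K) else 2 * K) t = 0.
    by apply/eqP; rewrite eq_le Ft Fge0.
  by rewrite mulf_eq0 (gt_eqF (expR_gt0 _)) orbF expf_eq0 => /eqP.
have cF c : continuous (F c).
  move=> s; apply/differentiable_continuous/derivable1_diffP.
  by have [] := FE c s.
have key s : `|2 * y s * dy s| <= 2 * K * y s ^+ 2.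
  rewrite !normrM ger0_norm// -real_normK ?num_real//.
  have := dyK s; have := normr_ge0 (y s); have := normr_ge0 (dy s).
  set A := `|y s|; set B := `|dy s| => B0 A0 BA.
  have := ler_wpM2l A0 BA; lra.
case: ifPn => [t0|]; last rewrite -ltNge => t0.
  have [c _] := MVT_segment t0 (fun x _ => FE (- (2 * K)) x)
    (continuous_subspaceT (cF _)).
  rewrite F0 subr0 => ->; rewrite subr0; apply: mulr_le0_ge0 => //.
  apply: mulr_le0_ge0; last exact: expR_ge0.
  by have := key c; rewrite ler_norml => /andP[_]; lra.
have [c _] := MVT_segment (ltW t0) (fun x _ => FE (2 * K) x)
  (continuous_subspaceT (cF _)).
rewrite F0 !sub0r => /(canRL (@opprK _)) ->; rewrite oppr_le0.
rewrite mulr_ge0 ?oppr_ge0 ?(ltW t0)// mulr_ge0 ?expR_ge0//.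
by have := key c; rewrite ler_norml => /andP[+ _]; lra.
Qed.

End Gronwall.

Section Components.
Variables (R : realType) (V W : normedModType R).

Lemma is_derive_fst (x : R -> V * W) (t : R) dx :
  is_derive t 1 x dx -> is_derive t 1 (fun s => (x s).1) dx.1.
Proof.
move=> [dxt <-].
have h : (fun h => h^-1 *: ((x (h *: (1 : R) + t)).1 - (x t).1)) @ 0^' -->
    ('D_1 x t).1.
  by have := cvg_comp _ _ dxt cvg_fst; exact.
by apply: DeriveDef; [apply/cvg_ex; eexists; exact: h|exact: cvg_lim h].
Qed.

Lemma is_derive_snd (x : R -> V * W) (t : R) dx :
  is_derive t 1 x dx -> is_derive t 1 (fun s => (x s).2) dx.2.
Proof.
move=> [dxt <-].
have h : (fun h => h^-1 *: ((x (h *: (1 : R) + t)).2 - (x t).2)) @ 0^' -->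
    ('D_1 x t).2.
  by have := cvg_comp _ _ dxt cvg_snd; exact.
by apply: DeriveDef; [apply/cvg_ex; eexists; exact: h|exact: cvg_lim h].
Qed.

End Components.

(** * The drift and its equilibrium *)

Section DriftAnalysis.
Variables (R : realType) (k : nat) (beta : R) (g : R -> R).
Hypothesis k_gt0 : (0 < k)%N.
Hypothesis beta_gt0 : 0 < beta.
Hypothesis g01 : forall y, 0 <= y <= 1 -> 0 <= g y <= 1.

Local Notation F1 := (F1 k g).
Local Notation F2 := (F2 k g).
Local Notation F3 := (F3 k g).
Local Notation G := (Gfun k beta g).

Let kR_gt0 : 0 < k%:R :> R. Proof. by rewrite ltr0n. Qed.

Let g_ratio i : (i <= k)%N -> 0 <= g (i%:R / k%:R) <= 1.
Proof.
by move=> ik; apply: g01; rewrite divr_ge0//= ler_pdivrMr// mul1r ler_nat.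
Qed.

(** [y g + (k - y) (1 - g) = 2 y g + (k - y) - k g]. *)
Lemma F3E q : 0 <= q <= 1 -> F3 q = 2 * F2 q + k%:R * (1 - q) - k%:R * F1 q.
Proof.
move=> q01.
rewrite /F3 (_ : (fun y : nat => _) = fun i : nat =>
   2 * (i%:R * g (i%:R / k%:R)) +
   (k%:R + ((-1) * i%:R + (- k%:R) * g (i%:R / k%:R)))); last first.
  by apply/funext => i; ring.
rewrite !binomial_meanD// !binomial_meanZ// binomial_mean_cst//.
rewrite binomial_mean_id//.
by rewrite /F1 /F2; ring.
Qed.

(** With [w = F2 + beta F1] and [v = F3 + beta] the drifts of numerator and
    denominator of [qbeta], [G = w - q v] is the drift of the ratio. *)
Lemma GfunE q : 0 <= q <= 1 ->
  G q = F2 q + beta * F1 q - q * (F3 q + beta).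
Proof. by move=> q01; rewrite F3E// /Gfun; ring. Qed.

Lemma drift_image_in_domain q : 0 <= q <= 1 ->
  drift_domain k (F1 q, F2 q, F3 q).
Proof.
move=> q01.
have lo phi : (forall i, (i <= k)%N -> 0 <= phi i) ->
    0 <= binomial_mean k q phi.
  by move=> h; rewrite -[leLHS](binomial_mean_cst k 0 q01) binomial_mean_le.
have up phi c : (forall i, (i <= k)%N -> phi i <= c) ->
    binomial_mean k q phi <= c.
  by move=> h; rewrite -[leRHS](binomial_mean_cst k c q01) binomial_mean_le.
have ki i : (i <= k)%N -> 0 <= k%:R - i%:R :> R by rewrite subr_ge0 ler_nat.
split => /=.
- by rewrite lo ?up// => i /g_ratio/andP[].
- rewrite lo ?up// => i ik; have /andP[g0 g1] := g_ratio ik; last first.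
    by rewrite mulr_ge0.
  by have := ki _ ik; have := ler_wpM2l (ler0n R i) g1; lra.
- rewrite lo ?up// => i ik; have /andP[g0 g1] := g_ratio ik;
    have := ki _ ik => kik.
    have := ler_wpM2l (ler0n R i) g1; have := mulr_ge0 kik g0; lra.
  by rewrite addr_ge0// mulr_ge0// subr_ge0.
- apply: binomial_mean_le => // i ik; have /andP[g0 g1] := g_ratio ik.
  by rewrite lerDl mulr_ge0 ?ki// subr_ge0.
Qed.

Definition Gpoly : {poly R} :=
  (1 - 2 *: 'X) * binomial_mean_poly k (fun y => y%:R * g (y%:R / k%:R))
  + (beta%:P + k%:R *: 'X) * binomial_mean_poly k (fun y => g (y%:R / k%:R))
  - (k%:R *: 'X) * (1 - 'X) - beta *: 'X.

Lemma horner_Gpoly q : 0 <= q <= 1 -> Gpoly.[q] = G q.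
Proof.
move=> q01; rewrite /Gpoly /Gfun /F1 /F2 !binomial_meanE//.
by rewrite !hornerE.
Qed.

Section UniqueRoot.
Variable qs : R.
Hypothesis g0 : 0 < g 0.
Hypothesis g1 : g 1 < 1.
Hypothesis qs01 : 0 < qs < 1.
Hypothesis G_unique : forall q, 0 < q < 1 -> G q = 0 -> q = qs.

Let G0 : 0 < G 0.
Proof.
rewrite /Gfun /F1 /F2 !binomial_mean0 !mul0r.
by rewrite !mulr0 !mul0r !subr0 addr0 add0r mulr_gt0.
Qed.

Let G1 : G 1 < 0.
Proof.
rewrite /Gfun /F1 /F2 !binomial_mean1 divff ?lt0r_neq0// subrr.
have := ltr_pM2l beta_gt0 (g 1) 1; rewrite g1 => /idP; lra.
Qed.

Let cG a b : {within `[a, b], continuous (horner Gpoly)}.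
Proof. exact/continuous_subspaceT/continuous_horner. Qed.

(* A value of the wrong sign would give, by the intermediate value theorem,
   a root on the wrong side of [qs]. *)
Let G_neg q : qs < q <= 1 -> G q < 0.
Proof.
move=> /andP[q1 q2]; have /andP[s0 s1] := qs01; rewrite ltNge; apply/negP => Gq.
have q01 : 0 <= q <= 1 by apply/andP; split; lra.
have [c] : exists2 c, c \in `[q, 1] & Gpoly.[c] = 0.
  apply: IVT => //; rewrite !horner_Gpoly// ?ler01 ?lexx//.
  by rewrite ge_min le_max (ltW G1) Gq orbT.
rewrite in_itv/= => /andP[c1 c2].
have c01 : 0 <= c <= 1 by apply/andP; split; lra.
rewrite horner_Gpoly// => Gc.
have cn1 : c != 1.
  by apply/eqP => c1E; rewrite c1E in Gc; move: G1; rewrite Gc ltxx.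
have c1' : c < 1 by rewrite lt_neqAle cn1.
have cqs : c = qs by apply: G_unique => //; apply/andP; split; lra.
lra.
Qed.

Let G_pos q : 0 <= q < qs -> 0 < G q.
Proof.
move=> /andP[q1 q2]; have /andP[s0 s1] := qs01; rewrite ltNge; apply/negP => Gq.
have q01 : 0 <= q <= 1 by apply/andP; split; lra.
have [c] : exists2 c, c \in `[0, q] & Gpoly.[c] = 0.
  apply: IVT => //; rewrite !horner_Gpoly// ?ler01 ?lexx//.
  by rewrite ge_min le_max (ltW G0) Gq orbT.
rewrite in_itv/= => /andP[c1 c2].
have c01 : 0 <= c <= 1 by apply/andP; split; lra.
rewrite horner_Gpoly// => Gc.
have cn0 : c != 0.
  by apply/eqP => c0E; rewrite c0E in Gc; move: G0; rewrite Gc ltxx.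
have c0' : 0 < c by rewrite lt_neqAle eq_sym cn0.
have cqs : c = qs by apply: G_unique => //; apply/andP; split; lra.
lra.
Qed.

(** Compactness of [[qs + eps, 1]] makes the sign of [G] uniform. *)
Lemma G_decreasing_side eps : 0 < eps -> exists2 c, 0 < c &
  forall q, 0 <= q <= 1 -> qs + eps <= q -> G q <= - c.
Proof.
move=> eps0; have [le1|gt1] := leP (qs + eps) 1; last first.
  by exists 1 => // q /andP[_ q1] q2; lra.
have [m + Hm] := EVT_max le1 (@cG _ _).
rewrite in_itv/= => /andP[m1 m2]; have /andP[s0 s1] := qs01.
have m01 : 0 <= m <= 1 by apply/andP; split; lra.
exists (- G m) => [|q q01 qq].
  by rewrite oppr_gt0 G_neg// m2 andbT; lra.
rewrite opprK -!horner_Gpoly//; apply: Hm; rewrite in_itv/= qq.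
by case/andP : q01.
Qed.

Lemma G_increasing_side eps : 0 < eps -> exists2 c, 0 < c &
  forall q, 0 <= q <= 1 -> q <= qs - eps -> c <= G q.
Proof.
move=> eps0; have [le1|gt1] := leP 0 (qs - eps); last first.
  by exists 1 => // q /andP[q1 _] q2; lra.
have [m + Hm] := EVT_min le1 (@cG _ _).
rewrite in_itv/= => /andP[m1 m2]; have /andP[s0 s1] := qs01.
have m01 : 0 <= m <= 1 by apply/andP; split; lra.
exists (G m) => [|q q01 qq].
  by rewrite G_pos// m1/=; lra.
rewrite -!horner_Gpoly//; apply: Hm; rewrite in_itv/= qq.
by case/andP : q01 => ->.
Qed.

End UniqueRoot.

Section Equilibrium.
Variable qs : R.
Hypothesis qs01 : 0 <= qs <= 1.
Hypothesis G_qs : G qs = 0.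

Let eqp : R * R * R := (F1 qs, F2 qs, F3 qs).

Lemma qbeta_equilibrium : qbeta beta eqp = qs.
Proof.
have [_ _ /andP[F30 _] _] := drift_image_in_domain qs01.
have F3b : F3 qs + beta != 0 by rewrite lt0r_neq0// ltr_wpDl.
rewrite /qbeta /=; apply: (mulIf F3b); rewrite divfK//.
by apply/eqP; rewrite -subr_eq0 -GfunE// G_qs.
Qed.

Lemma qbeta01 z : drift_domain k z -> 0 <= qbeta beta z <= 1.
Proof.
move=> [/andP[a0 a1] /andP[b0 b1] /andP[c0 c1] bc].
have d0 : 0 < z.2 + beta by rewrite ltr_wpDl.
rewrite /qbeta divr_ge0 ?(ltW d0) ?addr_ge0 ?mulr_ge0 ?(ltW beta_gt0)//=.
by rewrite ler_pdivrMr// mul1r lerD// ler_piMr// ltW.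
Qed.

Lemma Gfun_lipschitz : exists L : R,
  forall q, 0 <= q <= 1 -> `|G q| <= L * `|q - qs|.
Proof.
have /factor_theorem[r Gr] : root Gpoly qs by apply/rootP; rewrite horner_Gpoly.
have [L HL] := poly_itv_bound r 0 1; exists L => q q01.
rewrite -horner_Gpoly// Gr !hornerE normrM ler_wpM2r//.
exact: HL.
Qed.

(** [y = b + beta a - qs (c + beta)] equals [(q - qs) (c + beta)]; working with
    this linear function of the state avoids differentiating the quotient
    [qbeta]. *)
Lemma ode_solution_equilibrium x :
  ode_solution (drift_domain k) (drift k beta g) eqp x -> forall t, x t = eqp.
Proof.
move=> [x0 xE].
pose a t := (x t).1.1; pose b t := (x t).1.2; pose c t := (x t).2.
pose q t := qbeta beta (x t).
have q01 t : 0 <= q t <= 1 by apply: qbeta01; case: (xE t).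
have da (t : R) : is_derive t 1 a (F1 (q t) - a t).
  by have [_ h] := xE t; exact: is_derive_fst (is_derive_fst h).
have db (t : R) : is_derive t 1 b (F2 (q t) - b t).
  by have [_ h] := xE t; exact: is_derive_snd (is_derive_fst h).
have dc (t : R) : is_derive t 1 c (F3 (q t) - c t).
  by have [_ h] := xE t; exact: is_derive_snd h.
have [L HL] := Gfun_lipschitz.
have [M M0 HM] := binomial_mean_bound k (fun y => y%:R * g (y%:R / k%:R)
                            + (k%:R - y%:R) * (1 - g (y%:R / k%:R))).
pose y t := b t + beta * a t - qs * (c t + beta).
have yE t : y t = (q t - qs) * (c t + beta).
  have c0 : c t + beta != 0.
    by have [[_ _ /andP[c0 _] _] _] := xE t; rewrite lt0r_neq0// ltr_wpDl.
  by rewrite /y /q /qbeta mulrBl divfK.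
have qqs t : q t = qs.
  have y0 s : y s = 0.
    apply: (@gronwall_zero _ y
      (fun t => G (q t) + (q t - qs) * (F3 (q t) + beta) - y t)
      ((`|L| + M + beta) / beta + 1)).
    - move=> {}t; have ha := da t; have hb := db t; have hc := dc t.
      have -> : y = b + beta *: a - qs *: (c + cst beta) by apply/funext.
      apply: is_derive_eq; rewrite GfunE// -![_ *: _]/(_ * _).
      rewrite -[(b + _ - _) t]/(b t + beta * a t - qs * (c t + beta)); ring.
    - move=> {}t.
      have [[_ _ /andP[c0 _] _] _] := xE t.
      have qy : beta * `|q t - qs| <= `|y t|.
        rewrite yE normrM mulrC ler_wpM2l// ger0_norm ?lerDr//.
        by rewrite addr_ge0// ltW.
      have h1 : `|G (q t)| <= `|L| * `|q t - qs|.
        by apply: le_trans (HL _ (q01 t)) _; rewrite ler_wpM2r// ler_norm.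
      have h2 : `|(q t - qs) * (F3 (q t) + beta)| <= (M + beta) * `|q t - qs|.
        rewrite normrM mulrC ler_wpM2r// (le_trans (ler_normD _ _))//.
        by rewrite lerD ?HM// gtr0_norm.
      apply: le_trans (ler_normB _ _) _; rewrite [leRHS]mulrDl mul1r lerD2r.
      apply: le_trans (ler_normD _ _) _; apply: le_trans (lerD h1 h2) _.
      rewrite -mulrDl addrA -mulrA.
      rewrite ler_wpM2l ?addr_ge0 ?(ltW M0) ?(ltW beta_gt0)//.
      by rewrite mulrC ler_pdivlMr// mulrC.
    - by rewrite yE /q x0 qbeta_equilibrium subrr mul0r.
  have /eqP := y0 t; rewrite yE mulf_eq0 => /orP[|].
    by rewrite subr_eq0 => /eqP.
  by have [[_ _ /andP[c0 _] _] _] := xE t; rewrite gt_eqF// ltr_wpDl.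
have relax (z : R -> R) (l : R) : (forall t : R, is_derive t 1 z (l - z t)) ->
    z 0 = l -> forall t, z t = l.
  move=> dz z0 t; apply/eqP; rewrite -subr_eq0; apply/eqP.
  apply: (@gronwall_zero _ (fun t => z t - l) (fun t => l - z t) 1 _ _ _ t).
  - move=> s; have h := dz s.
    have -> : (fun t => z t - l) = z - cst l by apply/funext.
    by apply: is_derive_eq; rewrite subr0.
  - by move=> s; rewrite mul1r distrC.
  - by rewrite z0 subrr.
move=> t.
have ea : a t = F1 qs.
  by apply: (relax a) => [s|]; [have := da s; rewrite qqs|rewrite /a x0].
have eb : b t = F2 qs.
  by apply: (relax b) => [s|]; [have := db s; rewrite qqs|rewrite /b x0].
have ec : c t = F3 qs.
  by apply: (relax c) => [s|]; [have := dc s; rewrite qqs|rewrite /c x0].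
rewrite [LHS]surjective_pairing [(x t).1]surjective_pairing.
by rewrite -/(a t) -/(b t) -/(c t) ea eb ec.
Qed.

Lemma equilibrium_chain_transitive :
  internally_chain_transitive (drift_domain k) (drift k beta g) [set eqp].
Proof.
have inD : drift_domain k eqp := drift_image_in_domain qs01.
split.
- split => [_ -> //|_ ->]; split; last first.
    by move=> x /ode_solution_equilibrium xE t; rewrite /= xE.
  exists (cst eqp); split => // t; split => //.
  rewrite /drift /= qbeta_equilibrium subrr; exact: is_derive_cst.
- exact: compact_set1.
- move=> u v eps T0 -> -> eps0 T00.
  exists 1%N, (fun=> eqp), (fun=> T0); split => // i _; split => // x.
  by move=> /ode_solution_equilibrium ->; rewrite subrr normr0.
Qed.

End Equilibrium.

End DriftAnalysis.

(** * Integrals of functions of a finite label *)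

(** Between [m^2] and [(m+1)^2] a sequence with bounded increments moves by
    [O(m)], which is negligible with respect to [m^2]. *)
Lemma small_along_squares (R : realType) (S : nat -> R) (K : R) :
  (forall n, `|S n.+1 - S n| <= K) ->
  (fun m => (S (m.+1 ^ 2)%N / (m.+1 ^ 2)%:R) ^+ 2) @ \oo --> 0 ->
  (fun n => S n / n%:R) @ \oo --> 0.
Proof.
move=> SK S2.
have K0 : 0 <= K by apply: le_trans (SK 0%N).
have lip n m : `|S (n + m)%N - S n| <= K * m%:R.
  elim: m => [|m IH]; first by rewrite addn0 subrr normr0 mulr0.
  rewrite addnS -natr1 mulrDr mulr1.
  have -> : S (n + m).+1 - S n =
      (S (n + m)%N - S n) + (S (n + m).+1 - S (n + m)%N) by ring.
  by rewrite (le_trans (ler_normD _ _))// lerD.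
have sq n : exists m, (m ^ 2 <= n < m.+1 ^ 2)%N.
  elim: n => [|n [m /andP[m1 m2]]]; first by exists 0%N.
  have [lt|ge] := ltnP n.+1 (m.+1 ^ 2); first by exists m; rewrite lt ltnW.
  exists m.+1; rewrite ge/=.
  have -> : n.+1 = (m.+1 ^ 2)%N by apply/eqP; rewrite eqn_leq m2.
  by rewrite ltn_exp2r.
apply/cvgr0Pnorm_le => eps eps0.
have e2 : 0 < (eps / 2) ^+ 2 by rewrite exprn_gt0// divr_gt0.
have [M1 _ HM1] := (cvgr0_norm_le _ S2) _ e2.
have [M2 _ HM2] : \forall m \near \oo, K * 4 <= eps * m%:R.
  near=> m; rewrite mulrC -ler_pdivrMl// mulrC.
  near: m; exact: nbhs_infty_ger.
pose M := (maxn M1.+1 M2).+1.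
exists (M ^ 2)%N => // n /= Mn.
have [m /andP[m1 m2]] := sq n.
have Mm : (M <= m)%N.
  rewrite leqNgt; apply/negP => mM.
  have : (m.+1 ^ 2 <= M ^ 2)%N by rewrite leq_exp2r.
  by move=> h; have := leq_trans (leq_trans m2 h) Mn; rewrite ltnn.
have m0 : (0 < m)%N by rewrite (leq_trans _ Mm).
have mR : 0 < m%:R :> R by rewrite ltr0n.
have n0 : (0 < n)%N by rewrite (leq_trans _ m1)// expn_gt0 m0.
have nR : 0 < n%:R :> R by rewrite ltr0n.
have Sm : `|S (m ^ 2)%N| <= eps / 2 * m%:R ^+ 2.
  have : (M1 <= m.-1)%N by move: Mm; rewrite /M; lia.
  move=> /HM1 /=; rewrite prednK// normrX.
  rewrite ler_sqr ?nnegrE ?divr_ge0 ?(ltW eps0)//.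
  rewrite normf_div natrX (ger0_norm (exprn_ge0 2 (ltW mR))).
  by rewrite ler_pdivrMr// exprn_gt0.
have Km : K * 4 <= eps * m%:R by apply: HM2; move: Mm => /=; rewrite /M; lia.
have nm : (n - m ^ 2 <= 2 * m)%N by move: m2; nia.
rewrite normf_div (gtr0_norm nR) ler_pdivrMr//.
have := lip (m ^ 2)%N (n - m ^ 2)%N; rewrite subnKC// => Sn.
have S3 : `|S n| <= `|S (m ^ 2)%N| + K * (n - m ^ 2)%:R.
  by rewrite -[S n](subrKC (S (m ^ 2)%N)) (le_trans (ler_normD _ _))// lerD2l.
apply: le_trans S3 _.
have h1 : K * (n - m ^ 2)%:R <= K * (2 * m%:R).
  by rewrite ler_wpM2l// -natrM ler_nat.
have h2 : K * (2 * m%:R) <= eps / 2 * m%:R ^+ 2.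
  have := ler_wpM2r (ltW mR) Km; rewrite expr2; lra.
have h3 : eps * m%:R ^+ 2 <= eps * n%:R by rewrite ler_pM2l// -natrX ler_nat.
lra.
Unshelve. all: by end_near. Qed.

Section FiniteLabels.
Context {d : measure_display} {T : measurableType d} {R : realType}.
Variable P : probability T R.

Lemma measurable_forall (I : finType) (E : I -> set T) :
  (forall i, measurable (E i)) -> measurable [set w | forall i, E i w].
Proof.
move=> mE; rewrite (_ : [set w | _] = \bigcap_(i in [set: I]) E i); last first.
  by apply/seteqP; split => w /= h i; [move=> _|]; exact: h.
by apply: fin_bigcap_measurable => //; exact: finite_finset.
Qed.

Variables (I : finType) (label : T -> I).
Hypothesis label_measurable : forall i, measurable [set w | label w = i].

Lemma label_fun_measurable (V : set T) :
  (forall w w', label w = label w' -> V w -> V w') -> measurable V.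
Proof.
move=> VE.
rewrite (_ : V = \bigcup_(i in [set i | exists2 w, V w & label w = i])
    [set w | label w = i]).
  by apply: fin_bigcup_measurable.
apply/seteqP; split => [w Vw|w [i [w' Vw' <-]] /= ww'].
  by exists (label w) => //; exists w.
by apply: (VE w') Vw'.
Qed.

Variable h : T -> R.
Hypothesis h_label : forall w w', label w = label w' -> h w = h w'.

Let label_repr w : h w = h (xget point [set w' | label w' = label w]).
Proof.
by apply: h_label; case: xgetP => [w' _ <-//|/(_ w)]; rewrite /= => /(_ erefl).
Qed.

Lemma label_integrable : P.-integrable setT (EFin \o h).
Proof.
apply: measurable_bounded_integrable => //.
- by rewrite fin_num_fun_lty//; exact: fin_num_measure.
- move=> _ V mV; apply: label_fun_measurable => w w' ww' [_ Vw].
  by split => //=; rewrite -(h_label ww').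
- pose M := \sum_i `|h (xget point [set w | label w = i])|.
  exists M; split; first exact: num_real.
  move=> M' MM' w _ /=; apply: le_trans (ltW MM').
  by rewrite {1}label_repr /M (bigD1 (label w))//= lerDl sumr_ge0.
Qed.

(** The value of [h] is read off at an arbitrary point of each fiber of
    [label]; for an empty fiber the default point of [xget] is harmless,
    because the fiber has probability 0. *)
Lemma label_integral : (\int[P]_w (h w)%:E =
  \sum_i (h (xget point [set w | label w = i]))%:E * P [set w | label w = i])%E.
Proof.
pose c i := h (xget point [set w | label w = i]).
have hE w : h w = \sum_i c i * \1_[set w | label w = i] w.
  rewrite (bigD1 (label w))//= indicE mem_set// mulr1 big1 ?addr0 => [|i il].
    exact: label_repr.
  by rewrite indicE memNset ?mulr0//= => li; rewrite li eqxx in il.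
under eq_integral do rewrite hE -sumEFin.
rewrite integral_sum//.
  apply: eq_bigr => i _; under eq_integral do rewrite EFinM.
  rewrite integralZl//; last exact: integrable_indic.
  by rewrite integral_indic// setIT.
move=> i; under eq_fun do rewrite EFinM.
by apply: integrableZl => //; exact: integrable_indic.
Qed.

End FiniteLabels.

(** * The noise is negligible almost surely *)

Section AlmostSureConvergence.
Context {d : measure_display} {T : measurableType d} {R : realType}.
Variable P : probability T R.

(** The series of the [a m] has finite integral, hence converges almost
    everywhere.  The partial sums of [1/m^2] are bounded by [2 - 1/M]. *)
Lemma ae_cvg0_of_summable (a : nat -> T -> R) (C : R) :
  (forall m, measurable_fun setT (a m)) -> (forall m w, 0 <= a m w) ->
  (forall m, (\int[P]_w (a m w)%:E <= (C / m.+1%:R ^+ 2)%:E)%E) ->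
  {ae P, forall w, a ^~ w @ \oo --> 0}.
Proof.
move=> ma a0 aC.
have ma' m : measurable_fun [set: T] (fun w => (a m w)%:E).
  exact/measurable_EFinP.
have C0 : 0 <= C.
  have : (0 <= (C / 1%:R ^+ 2)%:E)%E.
    by apply: le_trans (aC 0%N); apply: integral_ge0 => w _; rewrite lee_fin.
  by rewrite lee_fin expr1n divr1.
pose tot w := (\sum_(m <oo) (a m w)%:E)%E.
have tot0 w : (0 <= tot w)%E by apply: nneseries_ge0 => m _ _; rewrite lee_fin.
have sumle M : \sum_(0 <= m < M) C / m.+1%:R ^+ 2 <= 2 * C.
  suff : \sum_(0 <= m < M) C / m.+1%:R ^+ 2 <= C * (2 - M%:R^-1) \/ M = 0%N.
    case=> [|->]; last by rewrite big_geq// mulr_ge0.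
    by move/le_trans; apply; rewrite mulrC ler_wpM2r// gerBl invr_ge0.
  elim: M => [|M [IH|->]]; [by right|left|left]; rewrite big_nat_recr//=.
  + case: M IH => [|M] IH.
      by rewrite big_geq// add0r expr1n; lra.
    apply: le_trans (lerD IH (lexx _)) _.
    rewrite -mulrDr ler_wpM2l//.
    have p1 : 0 < M.+1%:R :> R by rewrite ltr0n.
    have p2 : 0 < M.+2%:R :> R by rewrite ltr0n.
    rewrite -addrA lerD2l lerNr opprD opprK addrC.
    have -> : (M.+1%:R^-1 : R) = M.+2%:R^-1 + M.+1%:R^-1 * M.+2%:R^-1.
      by rewrite -[in M.+2%:R](natr1 M.+1) in p2 *; field; rewrite !lt0r_neq0.
    rewrite -lerBlDl opprK lerD2l.
    by rewrite expr2 invfM ler_wpM2r ?invr_ge0// lef_pV2 ?posrE// ler_nat.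
  + by rewrite big_geq// add0r expr1n; lra.
have itot : P.-integrable setT tot.
  apply/integrableP; split.
    by apply: ge0_emeasurable_sum => // m w _; rewrite lee_fin.
  under eq_integral do rewrite gee0_abs//.
  rewrite integral_nneseries//; last by move=> m w _; rewrite lee_fin.
  apply: (@le_lt_trans _ _ (2 * C)%:E); last exact: ltry.
  apply: lime_le.
    apply: is_cvg_nneseries => m _ _.
    by apply: integral_ge0 => w _; rewrite lee_fin.
  apply: nearW => M.
  apply: (@le_trans _ _ (\sum_(0 <= m < M) (C / m.+1%:R ^+ 2)%:E)%E).
    by apply: lee_sum => m _.
  by rewrite sumEFin lee_fin.
have := integrable_ae measurableT itot.
apply: filterS => w /(_ I) fin.
apply: cvg_series_cvg_0; apply: nondecreasing_is_cvgn.
  by apply/nondecreasing_seqP => n; rewrite seriesSr lerDl.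
exists (fine (tot w)) => _ [n _ <-].
rewrite -lee_fin fineK// -sumEFin.
by rewrite /tot; apply: nneseries_lim_ge => m _; rewrite lee_fin.
Qed.

End AlmostSureConvergence.

Section Model.
Context (R : realType) (d : measure_display) (T : measurableType d).
Variables (P : probability T R) (N k : nat) (beta p : R) (f : R -> R).
Variables (X : nat -> T -> bool) (U : nat -> 'I_k -> T -> nat).
Hypothesis N_gt0 : (0 < N)%N.
Hypothesis k_gt0 : (0 < k)%N.
Hypothesis beta_gt0 : 0 < beta.
Hypothesis model : polya_model N X U P beta p f.

Let g := gfun p f.
Hypothesis g01 : forall y, 0 <= y <= 1 -> 0 <= g y <= 1.

Let x w := path_states X w.
Let u w := path_samples U w.

Let u_lt w n j : (N <= n)%N -> (u w n j < n)%N.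
Proof. by move=> Nn; exact: (polya_samples_lt model). Qed.

(** The fibers of this map are the atoms of the sigma-field [history N X U n].
    The samples before [N] are masked, since they carry no information on the
    multigraph and need not be measurable; those drawn at epoch [l < n] are
    smaller than [n], so that [inord] loses nothing. *)
Definition history_label (n : nat) (w : T) :
    {ffun 'I_n -> bool} * {ffun 'I_n * 'I_k -> 'I_n.+1} :=
  ([ffun i : 'I_n => X i w],
   [ffun z : 'I_n * 'I_k => inord (if (N <= z.1)%N then U z.1 z.2 w else 0%N)]).

Lemma history_labelP n w w' : history_label n w = history_label n w' ->
  (forall i, (i < n)%N -> x w i = x w' i) /\
  (forall l j, (N <= l < n)%N -> u w l j = u w' l j).
Proof.
move=> [/ffunP xE /ffunP uE]; split => [i ni|l j /andP[Nl ln]].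
  by have := xE (Ordinal ni); rewrite !ffunE.
have := uE (Ordinal ln, j); rewrite !ffunE /= Nl => /(congr1 val) /=.
by rewrite !inordK // ltnS ltnW// (ltn_trans _ ln)// u_lt.
Qed.

Lemma history_label_history n a :
  history N X U n [set w | history_label n w = a].
Proof.
pose H := [set E : set T | exists i s, (i < n)%N /\ E = [set w | X i w = s]] `|`
  [set E | exists l j m, (N <= l < n)%N /\ E = [set w | U l j w = m]].
suff : @measurable _ (g_sigma_algebraType H)
  [set w | history_label n w = a] by [].
pose EX (i : 'I_n) := [set w | X i w = a.1 i].
pose EU (z : 'I_n * 'I_k) :=
  [set w | inord (if (N <= z.1)%N then U z.1 z.2 w else 0%N) = a.2 z].
rewrite (_ : [set w | history_label n w = a] =
    [set w | forall i, EX i w] `&` [set w | forall z, EU z w]); last first.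
  apply/seteqP; split => w /=.
    by move=> wa; split=> z; rewrite /EX /EU /= -wa ffunE.
  move=> [h1 h2]; rewrite [RHS]surjective_pairing; congr (_, _).
    by apply/ffunP => i; rewrite ffunE h1.
  by apply/ffunP => i; rewrite ffunE h2.
apply: (@measurableI _ (g_sigma_algebraType H)).
  apply: (@measurable_forall _ (g_sigma_algebraType H)) => i.
  by apply: (@sub_sigma_algebra _ setT H); left; exists i, (a.1 i); split.
apply: (@measurable_forall _ (g_sigma_algebraType H)) => -[l j].
rewrite /EU /=; have [Nl|_] := boolP (N <= l)%N.
  apply: (@sub_sigma_algebra _ setT H); right; exists l, j, (a.2 (l, j)).
  split; first by rewrite Nl ltn_ord.
  have ll w : (U l j w < n.+1)%N.
    by rewrite ltnS ltnW// (ltn_trans (u_lt w j Nl)).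
  apply/seteqP; split => w /= e; first by rewrite -e inordK.
  by apply: val_inj; rewrite /= inordK.
have [e|e] := eqVneq (inord 0) (a.2 (l, j)).
  by rewrite (_ : [set w | _] = setT)//; apply/seteqP; split.
rewrite (_ : [set w | _] = set0)//; apply/seteqP; split => // w /= e'.
by rewrite e' eqxx in e.
Qed.

Lemma history_measurable n B : history N X U n B -> measurable B.
Proof.
apply: smallest_sub; first exact: sigma_algebra_measurable.
move=> E [[i [s [_ ->]]]|[l [j [m [/andP[Nl _] ->]]]]].
  have := polya_measurable_states model i measurableT (Y := [set s]).
  by rewrite setTI; apply.
have := polya_measurable_samples model j Nl measurableT (Y := [set m]).
by rewrite setTI; apply.
Qed.

(** On an atom a conditional probability is a number, and the defining
    integral identity becomes the elementary product formula. *)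
Lemma cond_prob_cst (F : set (set T)) (E B : set T) (h : T -> R) c :
  is_cond_prob P F E h -> F B -> measurable B -> (forall w, B w -> h w = c) ->
  P (E `&` B) = (c%:E * P B)%E.
Proof.
move=> [_ hE] FB mB hc; rewrite hE//.
rewrite (eq_integral (cst c%:E)); last by move=> w /[!inE] /hc ->.
by rewrite integral_cst.
Qed.

Section OneStep.
Variable n : nat.
Hypothesis Nn : (N <= n)%N.

Let atom w0 := [set w | history_label n w = history_label n w0].

Definition sample_label (w : T) : {ffun 'I_k -> 'I_n} :=
  [ffun j => Ordinal (u_lt w j Nn)].

Definition step_label (w : T) := (history_label n w, (sample_label w, X n w)).

Lemma sample_labelE m :
  [set w | sample_label w = m] = [set w | forall j, [set w | U n j w = m j] w].
Proof.
apply/seteqP; split => w /=.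
  by move=> <- j; rewrite ffunE.
by move=> h; apply/ffunP => j; rewrite ffunE; apply: val_inj; exact: h.
Qed.

Lemma step_labelE w a m s : step_label w = (a, (m, s)) <->
  X n w = s /\ sample_label w = m /\ history_label n w = a.
Proof.
rewrite /step_label; move: (history_label n w) (sample_label w) => h m'.
by split => [[-> -> ->]|[-> [-> ->]]].
Qed.

Lemma step_labelP w w' : step_label w = step_label w' ->
  [/\ history_label n w = history_label n w',
      (forall j, u w n j = u w' n j) & x w n = x w' n].
Proof.
move=> /step_labelE[h1 [h2 h3]]; split => // j.
by move/ffunP : h2 => /(_ j); rewrite !ffunE => /(congr1 val).
Qed.

Lemma sample_plus_label w w0 : history_label n w = history_label n w0 ->
  sample_plus (x w) (u w) n = #|[set j | x w0 (sample_label w j)]%SET|.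
Proof.
move=> /history_labelP[xE _]; apply: eq_card => j.
by rewrite !inE ffunE /= xE// u_lt.
Qed.

Lemma prob_sample w0 (m : {ffun 'I_k -> 'I_n}) :
  P ([set w | sample_label w = m] `&` atom w0) =
  ((\prod_(j < k) attach_prob N (x w0) (u w0) beta n (m j))%:E * P (atom w0))%E.
Proof.
have lt j : (m j < n)%N by [].
have cp := polya_samples_law model Nn lt.
rewrite -(cond_prob_cst cp (history_label_history _)
  (history_measurable (history_label_history _))); last first.
  move=> w /history_labelP[xE uE]; apply: eq_bigr => j _.
  by apply: (@attach_prob_local N k n) => // l i; exact: u_lt.
by rewrite sample_labelE.
Qed.

Lemma sample_atom_history w0 m :
  history_and_sample N X U n ([set w | sample_label w = m] `&` atom w0).
Proof.
pose H := history N X U n `|` [set E | exists j m, E = [set w | U n j w = m]].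
suff : @measurable _ (g_sigma_algebraType H)
  ([set w | sample_label w = m] `&` atom w0) by [].
apply: (@measurableI _ (g_sigma_algebraType H)); last first.
  by apply: (@sub_sigma_algebra _ setT H); left; exact: history_label_history.
rewrite sample_labelE.
apply: (@measurable_forall _ (g_sigma_algebraType H)) => j.
by apply: (@sub_sigma_algebra _ setT H); right; exists j, (m j).
Qed.

Lemma sample_atom_measurable w0 m :
  measurable ([set w | sample_label w = m] `&` atom w0).
Proof.
apply: measurableI; last exact: history_measurable (history_label_history _).
rewrite sample_labelE; apply: measurable_forall => j.
have := polya_measurable_samples model j Nn measurableT (Y := [set val (m j)]).
by rewrite setTI; apply.
Qed.

Let state_measurable s : measurable [set w | X n w = s].
Proof.
have := polya_measurable_states model n measurableT (Y := [set s]).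
by rewrite setTI; apply.
Qed.

Lemma step_label_measurable i : measurable [set w | step_label w = i].
Proof.
have [[w0 w0i]|none] := pselect (exists w0, history_label n w0 = i.1);
  last first.
  rewrite (_ : [set w | _] = set0)//; apply/seteqP; split => // w /= wi.
  by apply: none; exists w; rewrite -wi.
rewrite (_ : [set w | _] = [set w | X n w = i.2.2] `&`
    ([set w | sample_label w = i.2.1] `&` atom w0)).
  by apply: measurableI => //; exact: sample_atom_measurable.
case: i w0i => [a [m s]] /= w0a; apply/seteqP; split => w /=.
  by rewrite /atom /= w0a => /step_labelE.
by rewrite /atom /= w0a => ?; apply/step_labelE.
Qed.

(** The joint law of the sample and of the new state on an atom of the
    history. *)
Lemma prob_step w0 (m : {ffun 'I_k -> 'I_n}) (s : bool) :
  let y := g (#|[set j | x w0 (m j)]%SET|%:R / k%:R) in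
  P [set w | step_label w = (history_label n w0, (m, s))] =
  (((if s then y else 1 - y) *
   (\prod_(j < k) attach_prob N (x w0) (u w0) beta n (m j)))%:E * P (atom w0))%E.
Proof.
move=> y.
set B := [set w | sample_label w = m] `&` atom w0.
have E s' : [set w | step_label w = (history_label n w0, (m, s'))] =
    [set w | X n w = s'] `&` B.
  apply/seteqP; split => w /=.
    by rewrite /B /atom /= => /step_labelE.
  by rewrite /B /atom /= => ?; apply/step_labelE.
have mB : measurable B := sample_atom_measurable w0 m.
have Pt : P ([set w | X n w = true] `&` B) = (y%:E * P B)%E.
  apply: (cond_prob_cst (polya_state_law model Nn)
    (sample_atom_history w0 m)) => //.
  by move=> w /= [mw aw]; rewrite /y -mw -(sample_plus_label aw).
have fB : P B \is a fin_num by exact: fin_num_measure.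
rewrite EFinM -muleA -prob_sample -/B E; case: s => //.
have -> : [set w | X n w = false] `&` B = B `\` [set w | X n w = true].
  apply/seteqP; split => w /=; first by move=> [-> ?].
  by move=> [? /negP]; case: (X n w).
have -> : P (B `\` [set w | X n w = true]) =
    (P B - P ([set w | X n w = true] `&` B))%E.
  rewrite [in RHS]setIC; apply: measureD => //.
  exact: (le_lt_trans (probability_le1 _ mB) (ltry _)).
rewrite Pt -(fineK fB) -!EFinM -EFinB; congr (_%:E); ring.
Qed.

End OneStep.

Section Noise.
Variables (delta : bool -> nat -> R) (D : R).
Hypothesis delta_le : forall s y, (y <= k)%N -> `|delta s y| <= D.

(** A statistic whose increment is [delta] of the new state and of the number
    of sampled +1 vertices has conditional mean increment [mean_step] given
    that number. *)
Definition mean_step (i : nat) : R :=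
  g (i%:R / k%:R) * delta true i + (1 - g (i%:R / k%:R)) * delta false i.

Definition noise (n : nat) (w : T) : R :=
  delta (X n w) (sample_plus (x w) (u w) n) -
  binomial_mean k (qbeta beta (scaled_stats R N (x w) (u w) n)) mean_step.

Definition noise_sum (n : nat) (w : T) : R := \sum_(N <= i < n) noise i w.

Lemma noise_step_label n (Nn : (N <= n)%N) w w' :
  step_label Nn w = step_label Nn w' -> noise n w = noise n w'.
Proof.
move=> /step_labelP[hl uE xE]; rewrite /noise.
rewrite (_ : X n w = X n w')// (sample_plus_label Nn hl).
rewrite (sample_plus_label Nn (erefl (history_label n w'))).
have [xx uu] := history_labelP hl.
congr (delta _ _ - binomial_mean _ (qbeta _ _) _).
  apply: eq_card => j; rewrite !inE !ffunE /=; congr (x w' _); exact: uE.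
by apply: (@scaled_stats_local N k n) => // l j; exact: u_lt.
Qed.

Lemma noise_history_label n m w w' : (N <= m < n)%N ->
  history_label n w = history_label n w' -> noise m w = noise m w'.
Proof.
move=> /andP[Nm mn] /history_labelP[xx uu]; rewrite /noise.
rewrite (_ : X m w = X m w'); last exact: (xx m).
rewrite (@sample_plus_local N k n (x w) (x w') (u w) (u w')) ?Nm//; last first.
  by move=> l j; exact: u_lt.
congr (_ - binomial_mean _ (qbeta _ _) _).
apply: (@scaled_stats_local N k n) => //; last exact: ltnW.
by move=> l j; exact: u_lt.
Qed.

Lemma noise_sum_history_label n w w' :
  history_label n w = history_label n w' -> noise_sum n w = noise_sum n w'.
Proof.
by move=> hl; apply: eq_big_nat => i iN; exact: noise_history_label iN hl.
Qed.

Lemma noise_le n w : (N <= n)%N -> `|noise n w| <= 2 * D.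
Proof.
move=> Nn; have q01 : 0 <= qbeta beta (scaled_stats R N (x w) (u w) n) <= 1.
  by apply: qbeta_scaled_01 => //; exact: (leq_trans N_gt0 Nn).
have mD i : (i <= k)%N -> - D <= mean_step i <= D.
  move=> ik; have /andP[g0 g1] : 0 <= g (i%:R / k%:R) <= 1.
    by apply: g01; rewrite divr_ge0//= ler_pdivrMr ?ltr0n// mul1r ler_nat.
  have := delta_le true ik; have := delta_le false ik.
  rewrite !ler_norml /mean_step; set G := g _ in g0 g1 *.
  move=> /andP[f1 f2] /andP[t1 t2].
  have G1 : 0 <= 1 - G by rewrite subr_ge0.
  have := ler_wpM2l g0 t1; have := ler_wpM2l g0 t2.
  have := ler_wpM2l G1 f1; have := ler_wpM2l G1 f2.
  by move=> *; apply/andP; split; lra.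
apply: le_trans (ler_normB _ _) _; rewrite mulr_natl mulr2n lerD//.
  by rewrite delta_le// sample_plus_le.
rewrite ler_norml -[X in X <= _ <= _](binomial_mean_cst k (- D) q01).
rewrite -[X in _ <= _ <= X](binomial_mean_cst k D q01).
by rewrite !binomial_mean_le// => i /mD/andP[].
Qed.

(** The martingale difference property, tested against functions of the
    history.  On each atom the sum over the samples is a binomial mean, by
    [sum_over_samples], which is what [noise] subtracts. *)
Lemma noise_orthogonal n (Nn : (N <= n)%N) (phi : T -> R) :
  (forall w w', history_label n w = history_label n w' -> phi w = phi w') ->
  (\int[P]_w (phi w * noise n w)%:E = 0)%E.
Proof.
move=> phiE.
have hE w w' : step_label Nn w = step_label Nn w' ->
    phi w * noise n w = phi w' * noise n w'.
  move=> e; rewrite (noise_step_label e); congr (_ * _); apply: phiE.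
  by have [] := step_labelP e.
rewrite (label_integral P (@step_label_measurable n Nn) hE).
pose Z i := ((phi (xget point [set w | step_label Nn w = i]) *
  noise n (xget point [set w | step_label Nn w = i]))%:E *
  P [set w | step_label Nn w = i])%E.
rewrite (eq_bigr (fun i => Z (i.1, (i.2.1, i.2.2))))%E; last by case=> a [m s].
rewrite -(pair_bigA _ (fun a i => Z (a, (i.1, i.2))))/=.
apply: big1 => a _.
rewrite -(pair_bigA _ (fun m s => Z (a, (m, s))))/=.
have [[w0 w0a]|none] := pselect (exists w0, history_label n w0 = a); last first.
  apply: big1 => m _; apply: big1 => s _; rewrite /Z.
  rewrite [X in P X](_ : _ = set0) ?measure0 ?mule0//.
  apply/seteqP; split => // w /= /step_labelE[_ [_ wa]].
  by apply: none; exists w.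
pose q := qbeta beta (scaled_stats R N (x w0) (u w0) n).
pose c := phi w0.
pose at_ (m : {ffun 'I_k -> 'I_n}) :=
  \prod_(j < k) attach_prob N (x w0) (u w0) beta n (m j).
have ZE m s : Z (a, (m, s)) =
  ((c * (delta s #|[set j | x w0 (m j)]%SET| - binomial_mean k q mean_step) *
   (if s then g (#|[set j | x w0 (m j)]%SET|%:R / k%:R)
    else 1 - g (#|[set j | x w0 (m j)]%SET|%:R / k%:R)) * at_ m)%:E *
   P [set w | history_label n w = history_label n w0])%E.
  rewrite -[(c * _ * _ * _)%R]mulrA EFinM -muleA -prob_step /Z w0a.
  case: xgetP => [w _ wE|no]; last first.
    rewrite [X in P X](_ : _ = set0) ?measure0 ?mule0//.
    by apply/seteqP; split => // w /= /no.
  have [hl mE sE] : [/\ history_label n w = history_label n w0,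
      sample_label Nn w = m & X n w = s].
    by case/step_labelE: wE => -> [-> ->].
  congr (_%:E * _)%E.
  rewrite (phiE _ _ hl) /noise sE (sample_plus_label Nn hl) mE.
  congr (_ * (_ - binomial_mean _ (qbeta _ _) _)).
  have [xx uu] := history_labelP hl.
  by apply: (@scaled_stats_local N k n) => // l j; exact: u_lt.
under eq_bigr do under eq_bigr do rewrite ZE.
have fB : P [set w | history_label n w = history_label n w0] \is a fin_num.
  by apply: fin_num_measure; exact: history_measurable (history_label_history _).
rewrite -(fineK fB); set b := fine _.
under eq_bigr do under eq_bigr do rewrite -EFinM.
under eq_bigr do rewrite sumEFin.
rewrite sumEFin; congr (_%:E).
rewrite (eq_bigr (fun m : {ffun 'I_k -> 'I_n} => c * b *
  (at_ m * (mean_step #|[set j | x w0 (m j)]%SET| +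
    - binomial_mean k q mean_step)))); last first.
  by move=> m _; rewrite big_bool /= /mean_step; ring.
have q01 : 0 <= q <= 1.
  by apply: qbeta_scaled_01 => //; exact: (leq_trans N_gt0 Nn).
have n0 : (0 < n)%N by exact: (leq_trans N_gt0 Nn).
rewrite -mulr_sumr (@sum_over_samples R k n (x w0) _
  (fun i => mean_step i + - binomial_mean k q mean_step)
  (sum_attach_prob (R := R) N (x w0) (u w0) beta_gt0 n0)).
rewrite sum_attach_prob_plus// -binomial_meanE//.
by rewrite (binomial_meanD _ _ (fun=> _))// binomial_mean_cst// subrr mulr0.
Qed.

(** Orthogonality removes the cross terms, so that the second moments of the
    single noises, at most [(2D)^2] each, add up. *)
Lemma noise_sum_second_moment n :
  (\int[P]_w ((noise_sum n w) ^+ 2)%:E <= ((2 * D) ^+ 2 * n%:R)%:E)%E.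
Proof.
have D0 : 0 <= D by apply: le_trans (delta_le true (leq0n k)).
elim: n => [|n IH].
  rewrite mulr0; under eq_integral do rewrite /noise_sum big_geq// expr0n/=.
  by rewrite integral0.
have [Nn|nN] := leqP N n; last first.
  under eq_integral do rewrite /noise_sum big_geq// expr0n/=.
  by rewrite integral0 lee_fin mulr_ge0// exprn_ge0// mulr_ge0.
have SE w w' : step_label Nn w = step_label Nn w' ->
    noise_sum n w = noise_sum n w'.
  by move=> /step_labelP[hl _ _]; exact: noise_sum_history_label.
have XE := @noise_step_label n Nn.
have mL := @step_label_measurable n Nn.
have i1 : P.-integrable setT (EFin \o (fun w => noise_sum n w ^+ 2)).
  by apply: (label_integrable P mL) => w w' e; rewrite (SE w w').
have i2 : P.-integrable setT
    (EFin \o (fun w => (2 * noise_sum n w) * noise n w)).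
  by apply: (label_integrable P mL) => w w' e; rewrite (SE w w')// (XE w w').
have i3 : P.-integrable setT (EFin \o (fun w => noise n w ^+ 2)).
  by apply: (label_integrable P mL) => w w' e; rewrite (XE w w').
under eq_integral.
  move=> w _; rewrite /noise_sum big_nat_recr//= -/(noise_sum n w).
  rewrite (_ : (_ + _) ^+ 2 = noise_sum n w ^+ 2 +
    (2 * noise_sum n w * noise n w + noise n w ^+ 2)); last by ring.
  rewrite EFinD EFinD; over.
rewrite integralD//; last by apply: integrableD.
rewrite integralD// (noise_orthogonal Nn (phi := fun w => 2 * noise_sum n w)).
  rewrite add0e -[n.+1%:R]natr1 mulrDr mulr1 EFinD leeD//.
  have -> : ((2 * D) ^+ 2)%:E = (\int[P]_w (cst ((2 * D) ^+ 2)%:E w))%E.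
    by rewrite integral_cst// [X in (_ * X)%E](@probability_setT _ _ _ P) mule1.
  apply: le_integral => //.
    exact: (finite_measure_integrable_cst P ((2 * D) ^+ 2)).
  move=> w _; rewrite /= lee_fin -(real_normK (num_real _)) lerXn2r ?nnegrE//.
    by rewrite mulr_ge0.
  exact: noise_le.
by move=> w w' hl; rewrite (noise_sum_history_label hl).
Qed.

(** The second moments of [noise_sum (m^2) / m^2] are [O(1/m^2)]. *)
Lemma noise_sum_small :
  {ae P, forall w, (fun n => noise_sum n w / n%:R) @ \oo --> 0}.
Proof.
have D0 : 0 <= D by apply: le_trans (delta_le true (leq0n k)).
have := @ae_cvg0_of_summable _ _ _ P
  (fun m w => (noise_sum (m.+1 ^ 2) w / (m.+1 ^ 2)%:R) ^+ 2) ((2 * D) ^+ 2).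
have mS n : measurable_fun setT (noise_sum n).
  move=> _ V mV; rewrite setTI.
  apply: (@label_fun_measurable _ _ _ (history_label n)).
    by move=> a; exact: history_measurable (history_label_history _).
  by move=> w w' /noise_sum_history_label /= ->.
have h1 m : measurable_fun setT
    (fun w => (noise_sum (m.+1 ^ 2) w / (m.+1 ^ 2)%:R) ^+ 2).
  by apply: measurable_funX; apply: measurable_funM.
move=> /(_ h1 (fun m w => sqr_ge0 _)) H.
apply: filterS (H _).
  move=> w; apply: (@small_along_squares _ (noise_sum ^~ w) (2 * D)) => n.
  have [Nn|nN] := leqP N n; last first.
    by rewrite /noise_sum !big_geq// ?subrr ?normr0 ?mulr_ge0// ltnW.
  by rewrite /noise_sum big_nat_recr//= addrAC subrr add0r noise_le.
move=> m.
under eq_integral do rewrite exprMn mulrC EFinM.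
rewrite integralZl//; last first.
  apply: (@label_integrable _ _ _ P _ (history_label (m.+1 ^ 2))).
    by move=> a; exact: history_measurable (history_label_history _).
  by move=> w w' /noise_sum_history_label /= ->.
apply: (@le_trans _ _ (((m.+1 ^ 2)%:R^-1 ^+ 2)%:E *
  ((2 * D) ^+ 2 * (m.+1 ^ 2)%:R)%:E)%E).
  by rewrite lee_wpmul2l ?noise_sum_second_moment// lee_fin exprn_ge0.
rewrite -EFinM lee_fin natrX.
have : m.+1%:R != 0 :> R by [].
move: (m.+1%:R) => z z0.
by rewrite [leLHS](_ : _ = (2 * D) ^+ 2 / z ^+ 2)//; field.
Qed.

End Noise.

End Model.

(** * Convergence of the scaled statistics *)

(** A single sample path, on which the noises [SA], [SB] and [SC] of the three
    statistics are [o(n)]. *)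
Section PathwiseLimit.
Variables (R : realType) (N k : nat) (beta : R) (g : R -> R) (qs : R).
Variables (x : nat -> bool) (u : nat -> 'I_k -> nat).
Hypothesis N_gt0 : (0 < N)%N.
Hypothesis k_gt0 : (0 < k)%N.
Hypothesis beta_gt0 : 0 < beta.
Hypothesis g0 : 0 < g 0.
Hypothesis g1 : g 1 < 1.
Hypothesis qs01 : 0 < qs < 1.
Hypothesis G_unique : forall q, 0 < q < 1 -> Gfun k beta g q = 0 -> q = qs.
Hypothesis u_lt : forall n j, (N <= n)%N -> (u n j < n)%N.

Let Q n := qbeta beta (scaled_stats R N x u n).
Let y n := sample_plus x u n.
Let A n : R := (statA x n)%:R.
Let B n : R := (statB N x u n)%:R.
Let C n : R := (statC N x u n)%:R.

Variables SA SB SC : nat -> R.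
Hypothesis SA_E : forall n, (N <= n)%N ->
  SA n.+1 - SA n = (x n)%:R - F1 k g (Q n).
Hypothesis SB_E : forall n, (N <= n)%N ->
  SB n.+1 - SB n = (if x n then (y n)%:R else 0) - F2 k g (Q n).
Hypothesis SC_E : forall n, (N <= n)%N ->
  SC n.+1 - SC n = (if x n then (y n)%:R else k%:R - (y n)%:R) - F3 k g (Q n).
Hypothesis SA0 : (fun n => SA n / n%:R) @ \oo --> 0.
Hypothesis SB0 : (fun n => SB n / n%:R) @ \oo --> 0.
Hypothesis SC0 : (fun n => SC n / n%:R) @ \oo --> 0.

Let AE n : (N <= n)%N -> A n.+1 = A n + F1 k g (Q n) + (SA n.+1 - SA n).
Proof. by move=> Nn; rewrite SA_E// /A statAS natrD; ring. Qed.

Let BE n : (N <= n)%N -> B n.+1 = B n + F2 k g (Q n) + (SB n.+1 - SB n).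
Proof.
move=> Nn; rewrite SB_E// /B statBS// natrD -/(y n).
by case: (x n) => /=; ring.
Qed.

Let CE n : (N <= n)%N -> C n.+1 = C n + F3 k g (Q n) + (SC n.+1 - SC n).
Proof.
move=> Nn; rewrite SC_E// /C statCS// natrD -/(y n).
by case: (x n) => /=; rewrite ?natrB ?sample_plus_le//; ring.
Qed.

Lemma qbeta_scaled_cvg : Q @ \oo --> qs.
Proof.
have [M1 M1_0 HM1] := binomial_mean_bound k (fun y : nat => g (y%:R / k%:R)).
have [M2 M2_0 HM2] := binomial_mean_bound k
  (fun y : nat => y%:R * g (y%:R / k%:R)).
have [M3 M3_0 HM3] := binomial_mean_bound k (fun y : nat => y%:R * g (y%:R / k%:R)
                            + (k%:R - y%:R) * (1 - g (y%:R / k%:R))).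
have b0 : 0 < beta := beta_gt0.
pose W n := B n + beta * A n.
pose V n := C n + n%:R * beta.
pose K : R := k%:R + beta + M1 * beta + M2 + M3.
have M1b : 0 < M1 * beta by rewrite mulr_gt0.
have k0 : 0 <= k%:R :> R by [].
have QE n : (N <= n)%N -> W n / V n = Q n.
  by move=> Nn; rewrite /Q qbeta_scaled// (leq_trans N_gt0).
have Q01 n : (N <= n)%N -> 0 <= Q n <= 1.
  by move=> Nn; apply: qbeta_scaled_01 => //; exact: (leq_trans N_gt0 Nn).
have PR : perturbed_ratio W V (fun n => SB n + beta * SA n) SC
    (fun q => F2 k g q + beta * F1 k g q) (fun q => F3 k g q + beta) N beta K.
  split => //.
  - by rewrite /K; lra.
  - move=> n Nn; rewrite /V mulrC lerDr ler0n /=.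
    have h1 : C n <= k%:R * n%:R by rewrite -natrM ler_nat statC_le.
    have h2 : 0 <= (M1 * beta + M2 + M3) * n%:R by rewrite mulr_ge0//; lra.
    rewrite /K; lra.
  - by move=> n Nn; rewrite QE// Q01.
  - by move=> n Nn; rewrite QE// /W AE// BE//; ring.
  - by move=> n Nn; rewrite QE// /V CE// -natr1; ring.
  - rewrite (_ : (fun n => _) = fun n => SB n / n%:R + beta * (SA n / n%:R));
      last by apply/funext => n; ring.
    rewrite -[X in _ --> X](addr0 0) -[X in _ --> _ + X](mulr0 beta).
    by apply: cvgD => //; apply: cvgM => //; exact: cvg_cst.
  - move=> q q01; apply: le_trans (ler_normD _ _) _.
    rewrite normrM (gtr0_norm beta_gt0).
    have h1 := HM1 q q01; have h2 := HM2 q q01.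
    have := ler_wpM2r (ltW beta_gt0) h1; rewrite /F1 /F2 /K; lra.
  - move=> q q01; apply: le_trans (ler_normD _ _) _.
    rewrite (gtr0_norm beta_gt0).
    by have := HM3 q q01; rewrite /F3 /K; lra.
have dec eps : 0 < eps -> exists2 c, 0 < c & forall q, 0 <= q <= 1 ->
    qs + eps <= q -> F2 k g q + beta * F1 k g q - q * (F3 k g q + beta) <= - c.
  move=> /(G_decreasing_side k_gt0 beta_gt0 g1 qs01 G_unique)[c c0 Hc].
  by exists c => // q q01 /(Hc q q01); rewrite GfunE.
have inc eps : 0 < eps -> exists2 c, 0 < c & forall q, 0 <= q <= 1 ->
    q <= qs - eps -> c <= F2 k g q + beta * F1 k g q - q * (F3 k g q + beta).
  move=> /(G_increasing_side beta_gt0 g0 qs01 G_unique)[c c0 Hc].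
  by exists c => // q q01 /(Hc q q01); rewrite GfunE.
have := perturbed_ratio_cvg PR dec inc.
apply: cvg_trans; apply: near_eq_cvg; near=> n.
by rewrite QE//; near: n; exact: nbhs_infty_ge.
Unshelve. all: by end_near. Qed.

Lemma scaled_stats_cvg :
  cvg_to_set (scaled_stats R N x u) [set (F1 k g qs, F2 k g qs, F3 k g qs)].
Proof.
have qs01' : 0 <= qs <= 1 by have /andP[? ?] := qs01; rewrite !ltW.
have Q01 n : (N <= n)%N -> 0 <= Q n <= 1.
  by move=> Nn; apply: qbeta_scaled_01 => //; exact: (leq_trans N_gt0 Nn).
have QF (phi : nat -> R) : (fun n => binomial_mean k (Q n) phi) @ \oo -->
    binomial_mean k qs phi by exact: binomial_mean_cvg Q01 qs01' qbeta_scaled_cvg.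
have cv : scaled_stats R N x u @ \oo --> (F1 k g qs, F2 k g qs, F3 k g qs).
  have cA := average_cvg AE SA0 (QF (fun y : nat => g (y%:R / k%:R))).
  have cB := average_cvg BE SB0 (QF (fun y : nat => y%:R * g (y%:R / k%:R))).
  have cC := average_cvg CE SC0 (QF (fun y : nat => y%:R * g (y%:R / k%:R)
                            + (k%:R - y%:R) * (1 - g (y%:R / k%:R)))).
  exact: (cvg_pair (cvg_pair cA cB) cC).
rewrite /cvg_to_set; under eq_fun do rewrite image_set1 ereal_inf1.
apply: cvg_EFin; first exact: nearW.
rewrite (_ : fine \o _ = fun n =>
  `|scaled_stats R N x u n - (F1 k g qs, F2 k g qs, F3 k g qs)|);
  last by apply/funext.
rewrite -[X in _ --> X](@normr0 R (R * R * R)%type).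
rewrite -(subrr (F1 k g qs, F2 k g qs, F3 k g qs)).
by apply: cvg_norm; apply: cvgB => //; exact: cvg_cst.
Qed.

End PathwiseLimit.

Theorem theorem4p2 (R : realType) (d : measure_display) (T : measurableType d)
    (P : probability T R) (N k : nat) (beta p : R) (f : R -> R)
    (X : nat -> T -> bool) (U : nat -> 'I_k -> T -> nat) (qs : R)
    (hN : (1 <= N)%N) (hk : (1 <= k)%N) (hbeta : 0 < beta)
    (hp : 0 <= p <= 1) (hp2 : p != 1 / 2)
    (hf : forall y, 0 <= y <= 1 -> 0 <= f y <= 1)
    (hmodel : polya_model N X U P beta p f)
    (hg0 : 0 < gfun p f 0) (hg1 : gfun p f 1 < 1)
    (hqs : 0 < qs < 1) (hroot : Gfun k beta (gfun p f) qs = 0)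
    (huniq : forall q, 0 < q < 1 -> Gfun k beta (gfun p f) q = 0 -> q = qs) :
  {ae P, forall w, exists L : set (R * R * R),
    [/\ compact L, connected L,
        internally_chain_transitive (drift_domain k)
          (drift k beta (gfun p f)) L,
        L `<=` [set z | drift_domain k z /\ qbeta beta z = qs] &
        cvg_to_set (scaled_stats R N (path_states X w) (path_samples U w)) L]}.
Proof.
set g := gfun p f in hg0 hg1 hroot huniq *.
have g01 y : 0 <= y <= 1 -> 0 <= g y <= 1.
  move=> /hf/andP[f0 f1]; have /andP[p0 p1] := hp; rewrite /g /gfun.
  have h1 := mulr_ge0 p0 f0.
  have h2 : 0 <= p * (1 - f y) by rewrite mulr_ge0// subr_ge0.
  have h3 : 0 <= (1 - p) * f y by rewrite mulr_ge0// subr_ge0.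
  have h4 : 0 <= (1 - p) * (1 - f y) by rewrite mulr_ge0// subr_ge0.
  by apply/andP; split; lra.
have qs01 : 0 <= qs <= 1 by have /andP[? ?] := hqs; rewrite !ltW.
(* Increments of the three statistics as functions of the new state and of the
   number of sampled +1 vertices. *)
pose dA (s : bool) (i : nat) : R := s%:R.
pose dB (s : bool) (i : nat) : R := if s then i%:R else 0.
pose dC (s : bool) (i : nat) : R := if s then i%:R else k%:R - i%:R.
have k1 : 1 <= k%:R :> R by rewrite ler1n.
have dA_le s i : (i <= k)%N -> `|dA s i| <= k%:R.
  by move=> _; rewrite /dA normr_nat (le_trans _ k1)// lern1; case: s.
have dB_le s i : (i <= k)%N -> `|dB s i| <= k%:R.
  by move=> ik; rewrite /dB; case: s; rewrite ?normr_nat ?normr0 ?ler_nat.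
have dC_le s i : (i <= k)%N -> `|dC s i| <= k%:R.
  move=> ik; rewrite /dC; case: s; first by rewrite normr_nat ler_nat.
  by rewrite -natrB// normr_nat ler_nat leq_subr.
have smallA := noise_sum_small hN hk hbeta hmodel g01 dA_le.
have smallB := noise_sum_small hN hk hbeta hmodel g01 dB_le.
have smallC := noise_sum_small hN hk hbeta hmodel g01 dC_le.
apply: filterS3 smallA smallB smallC => w SA SB SC.
exists [set (F1 k g qs, F2 k g qs, F3 k g qs)]; split.
- exact: compact_set1.
- exact: connected1.
- exact: equilibrium_chain_transitive.
- move=> _ ->; split; first exact: drift_image_in_domain.
  exact: qbeta_equilibrium.
- have step delta F :
      (forall q, binomial_mean k q (mean_step k p f delta) = F q) ->
      forall n, (N <= n)%N ->
      noise_sum N beta p f X U delta n.+1 w -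
      noise_sum N beta p f X U delta n w =
      delta (path_states X w n)
        (sample_plus (path_states X w) (path_samples U w) n) -
      F (qbeta beta (scaled_stats R N (path_states X w) (path_samples U w) n)).
    move=> FE n Nn; rewrite /noise_sum big_nat_recr//= addrAC subrr add0r.
    by rewrite /noise FE.
  have lt n j : (N <= n)%N -> (path_samples U w n j < n)%N.
    by move=> Nn; exact: (polya_samples_lt hmodel).
  pose S delta n := noise_sum N beta p f X U delta n w.
  apply: (scaled_stats_cvg hN hk hbeta hg0 hg1 hqs huniq lt
    (SA := S dA) (SB := S dB) (SC := S dC) _ _ _ SA SB SC).
  + apply: (step dA) => q; congr binomial_mean; apply/funext => i.
    by rewrite /mean_step /dA -/g /=; ring.
  + apply: (step dB) => q; congr binomial_mean; apply/funext => i.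
    by rewrite /mean_step /dB -/g /=; ring.
  + apply: (step dC) => q; congr binomial_mean; apply/funext => i.
    by rewrite /mean_step /dC -/g /=; ring.
Qed.
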